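(* Let $u_0:\mathbb{R}\to\mathbb{R}$ be bounded and continuous. Let $dx,dt$ be positive infinitesimal hyperreals, let $N\in{}^*\mathbb{N}$ be an unlimited hypernatural number such that $N\,dx$ and $N\,dt$ are both unlimited, and let $$G_C=\{(m\,dx,n\,dt)\mid m\in{}^*\mathbb{Z},\ n\in{}^*\mathbb{N},\ |m|+n\le N\}.$$ Let $\alpha=dt/(dx)^2$ and suppose that $\alpha\le\frac12$. Let $U:G_C\to{}^*\mathbb{R}$ be the internal function determined by $U(x,0)=u_0(x)$ for all $x$ with $(x,0)\in G_C$ and $$\frac{U(x,t+dt)-U(x,t)}{dt}=\frac{U(x+dx,t)-2U(x,t)+U(x-dx,t)}{(dx)^2}$$ for all $(x,t)=(m\,dx,n\,dt)\in G_C$ with $|m|+n<N$. Then the expression $$\langle u,\varphi\rangle=\operatorname{St}\Bigl(\sum_{(x,t)\in G_C}U(x,t)\,\varphi(x,t)\,dx\,dt\Bigr),\qquad \varphi\in C_c^\infty(\mathbb{R}^2),$$ defines a distribution $u$ on $\mathbb{R}^2$ that satisfies $$u_t-u_{xx}=u_0(x)\,\delta(t)$$ in the sense of distributions on $\mathbb{R}^2$.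
   Context: The setting is nonstandard analysis with internal sets and functions: ${}^*\mathbb{R}$, ${}^*\mathbb{N}$ (containing $0$), ${}^*\mathbb{Z}$ are the nonstandard extensions of $\mathbb{R},\mathbb{N},\mathbb{Z}$. A hyperreal is limited if its absolute value is bounded by a standard real, and unlimited otherwise. $\operatorname{St}(a)$ is the standard part of a limited hyperreal $a$. Standard functions such as $u_0$ and $\varphi$ are extended to hyperreal arguments by transfer, with the same notation. The set $G_C$ is internal and hyperfinite, and the sum is the hyperfinite sum of an internal function over $G_C$. $C_c^\infty(\mathbb{R}^2)$ is the space of real-valued smooth compactly supported functions of $(x,t)\in\mathbb{R}^2$ (test functions). A distribution on $\mathbb{R}^2$ is a linear functional on $C_c^\infty(\mathbb{R}^2)$ that is continuous for the usual topology. ''$u$ satisfies $u_t-u_{xx}=u_0(x)\delta(t)$ in the sense of distributions'' means that for every $\varphi\in C_c^\infty(\mathbb{R}^2)$ $$\langle u,-\varphi_t-\varphi_{xx}\rangle=\int_{\mathbb{R}}u_0(x)\,\varphi(x,0)\,dx .$$ *)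

(* Defs.v *)
From HB Require Import structures.
From mathcomp Require Import all_boot all_order all_algebra generic_quotient.
From mathcomp Require Import all_classical all_reals all_analysis.

Set Implicit Arguments.
Unset Strict Implicit.
Unset Printing Implicit Defensive.

Import Order.TTheory GRing.Theory Num.Theory numFieldNormedType.Exports.

Local Open Scope classical_set_scope.
Local Open Scope quotient_scope.
Local Open Scope ring_scope.

Structure ultrafilter_on (I : Type) := UltrafilterOn {
  uset :> set_system I;
  uset_ultra : UltraFilter uset
}.
#[global] Existing Instance uset_ultra.

(* The nonstandard extension is the ultrapower along an ultrafilter F on an
   arbitrary index type I.  F is not required to be free: when [star F R] has
   no positive infinitesimal, a hypothesis that provides one is vacuous. *)
Section Star.
Context {I : Type} (F : ultrafilter_on I).

Definition aeq (T : Type) : rel {classic (I -> T)} :=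
  fun f g => `[< \forall i \near uset F, f i = g i >].

Lemma aeq_is_equiv (T : Type) : equiv_class_of (@aeq T).
Proof.
split=> [f|f g|g f h].
- by apply/asboolP; apply: nearW.
- by apply/asboolP/asboolP; apply: filterS.
- by move=> /asboolP fg /asboolP gh; apply/asboolP; move: fg gh; apply: filterS2 => i ->.
Qed.

Canonical aeq_equiv T := EquivRelPack (aeq_is_equiv T).

Definition star (T : Type) := {eq_quot (aeq_equiv T)}.

HB.instance Definition _ (T : Type) := Choice.on (star T).
HB.instance Definition _ (T : Type) := EqQuotient.on (star T).

Definition cls (T : Type) (f : I -> T) : star T :=
  \pi_(star T) (f : {classic (I -> T)}).

Definition rep (T : Type) (x : star T) : I -> T := repr x.

Lemma repK (T : Type) (x : star T) : cls (rep x) = x.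
Proof. exact: reprK. Qed.

Lemma clsP (T : Type) (f g : I -> T) :
  cls f = cls g <-> \forall i \near uset F, f i = g i.
Proof. by split=> [/eqquotP/asboolP|fg]; [|apply/eqquotP/asboolP]. Qed.

Lemma eq_cls (T : Type) (f g : I -> T) : f =1 g -> cls f = cls g.
Proof. by move=> /funext ->. Qed.

Lemma rep_cls (T : Type) (f : I -> T) : \forall i \near uset F, rep (cls f) i = f i.
Proof. by apply/clsP; rewrite repK. Qed.

Lemma starW (T : Type) (P : star T -> Prop) :
  (forall f, P (cls f)) -> forall x, P x.
Proof. by move=> Pcls x; rewrite -(repK x). Qed.

Lemma ultra_not (P : I -> Prop) :
  ~ (\forall i \near uset F, P i) <-> \forall i \near uset F, ~ P i.
Proof.
split=> [nP|nP FP]; first by case: (in_ultra_setVsetC P (uset_ultra F)).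
by have /filter_ex[i []] : \forall i \near uset F, P i /\ ~ P i by apply: filterI.
Qed.

Lemma ultra_or (P Q : I -> Prop) :
  (\forall i \near uset F, P i \/ Q i) ->
  (\forall i \near uset F, P i) \/ (\forall i \near uset F, Q i).
Proof.
move=> PQ; have [|/ultra_not nP] := pselect (\forall i \near uset F, P i); first by left.
by right; move: PQ nP; apply: filterS2 => i [].
Qed.

Lemma near_absurd (P Q : I -> Prop) :
  (\forall i \near uset F, P i) -> (\forall i \near uset F, Q i) ->
  (forall i, P i -> ~ Q i) -> False.
Proof.
move=> FP FQ PQ; have /filter_ex[i] : \forall i \near uset F, False.
  by move: FP FQ; apply: filterS2.
by [].
Qed.

Definition std (T : Type) (a : T) : star T := cls (fun=> a).

(* Extension by transfer of standard functions of one and of two variables. *)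
Definition smap (T S : Type) (f : T -> S) (x : star T) : star S :=
  cls (fun i => f (rep x i)).

Definition smap2 (T S V : Type) (f : T -> S -> V) (x : star T) (y : star S) :
  star V := cls (fun i => f (rep x i) (rep y i)).

Lemma smapE (T S : Type) (f : T -> S) u :
  smap f (cls u) = cls (fun i => f (u i)).
Proof. by apply/clsP; apply: filterS (rep_cls u) => i ->. Qed.

Lemma smap2E (T S V : Type) (f : T -> S -> V) u v :
  smap2 f (cls u) (cls v) = cls (fun i => f (u i) (v i)).
Proof.
by apply/clsP; move: (rep_cls u) (rep_cls v); apply: filterS2 => i -> ->.
Qed.

Definition spair (T S : Type) : star T -> star S -> star (T * S) := smap2 pair.

(* The elements of [star (set T)] and [star (T -> S)] are the internal subsets
   of [star T] and the internal functions from [star T] to [star S]; [sset] and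
   [sfun] give the external set and function that they determine.  In particular
   [sset (std A)] is the nonstandard extension of a standard set A. *)
Definition sset (T : Type) (A : star (set T)) : set (star T) :=
  [set x | \forall i \near uset F, rep A i (rep x i)].

Definition sfun (T S : Type) (f : star (T -> S)) : star T -> star S :=
  smap2 (fun f x => f x) f.

Lemma ssetE (T : Type) (A : I -> set T) x :
  sset (cls A) (cls x) <-> \forall i \near uset F, A i (x i).
Proof.
rewrite /sset/=; split; move: (rep_cls A) (rep_cls x);
  by apply: filterS3 => i -> ->.
Qed.

Lemma sfunE (T S : Type) (f : I -> T -> S) x :
  sfun (cls f) (cls x) = cls (fun i => f i (x i)).
Proof. exact: smap2E. Qed.

Lemma sfun_std (T S : Type) (f : T -> S) : sfun (std f) = smap f.
Proof. by apply/funext; apply: starW => x; rewrite sfunE smapE. Qed.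

Lemma near_choice (T : Type) (P : I -> T -> Prop) :
  (\forall i \near uset F, exists x, P i x) ->
  exists x : I -> T, \forall i \near uset F, P i (x i).
Proof.
move=> FP; have [i0 [x0 _]] := filter_ex FP.
have /choice[x xP] i : exists x, (exists y, P i y) -> P i x.
  by have [[y Py]|nP] := pselect (exists y, P i y); [exists y|exists x0].
by exists x; apply: filterS FP => i /xP.
Qed.

Lemma sset_inj (T : Type) : injective (@sset T).
Proof.
apply: starW => A; apply: starW => B AB; apply/clsP.
apply: contrapT => /ultra_not nAB.
have /near_choice[x] : \forall i \near uset F, exists x, ~ (A i x <-> B i x).
  apply: filterS nAB => i; apply: contra_notP => /forallNP ABi.
  by apply/funext => x; apply/propext; apply: contrapT; exact: ABi.
move=> nx; have : sset (cls A) (cls x) <-> sset (cls B) (cls x) by rewrite AB.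
rewrite !ssetE => -[ABx BAx].
have [Ax|/ultra_not nA] := pselect (\forall i \near uset F, A i (x i)).
  by apply: (near_absurd (filterI Ax (ABx Ax)) nx) => i -[Ai Bi]; apply.
have [Bx|/ultra_not nB] := pselect (\forall i \near uset F, B i (x i)).
  by apply: (near_absurd (filterI (BAx Bx) Bx) nx) => i -[Ai Bi]; apply.
by apply: (near_absurd (filterI nA nB) nx) => i -[nAi nBi]; apply; split.
Qed.

Lemma sfun_on_inj (T S : Type) (A : I -> set T) (f g : I -> T -> S) :
  (forall x, sset (cls A) x -> sfun (cls f) x = sfun (cls g) x) <->
  \forall i \near uset F, forall x, A i x -> f i x = g i x.
Proof.
split=> [fg|fg]; last first.
  apply: starW => x /ssetE Ax; rewrite !sfunE; apply/clsP.
  by move: fg Ax; apply: filterS2 => i; exact.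
apply: contrapT => /ultra_not nfg.
have /near_choice[x xP] : \forall i \near uset F, exists x, A i x /\ f i x <> g i x.
  apply: filterS nfg => i; apply: contra_notP => /forallNP nx x Ax.
  by apply: contrapT => fgx; apply: (nx x).
have /fg : sset (cls A) (cls x) by apply/ssetE; apply: filterS xP => i [].
rewrite !sfunE => /clsP fgx.
by apply: (near_absurd xP fgx) => i -[].
Qed.

Definition internal_on (T S : Type) (A : set (star T)) (f : star T -> star S) :=
  exists g : star (T -> S), forall x, A x -> f x = sfun g x.

Lemma internal_on_smap (T S : Type) (A : set (star T)) (f : T -> S) :
  internal_on A (smap f).
Proof. by exists (std f) => x _; rewrite sfun_std. Qed.

Lemma internal_on_cst (T S : Type) (A : set (star T)) (s : star S) :
  internal_on A (fun=> s).
Proof.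
elim/starW: s => s; exists (cls (fun i _ => s i)); apply: starW => x _.
by rewrite sfunE.
Qed.

Lemma internal_on_smap2 (T S S' V : Type) (A : set (star T)) (h : S -> S' -> V)
    (f : star T -> star S) (g : star T -> star S') :
  internal_on A f -> internal_on A g ->
  internal_on A (fun x => smap2 h (f x) (g x)).
Proof.
move=> [f' ff'] [g' gg']; move: f' g' ff' gg'.
apply: starW => f'; apply: starW => g' ff' gg'.
exists (cls (fun i x => h (f' i x) (g' i x))); apply: starW => x Ax.
by rewrite ff'// gg'// !sfunE smap2E.
Qed.

Definition hyperfinite (T : Type) (A : set (star T)) :=
  exists2 B : star (set T), A = sset B & sset (std finite_set) B.

End Star.

Section Hyperreal.
Context {I : Type} (F : ultrafilter_on I) (R : realFieldType).
Implicit Types x y z : star F R.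

Definition sadd : star F R -> star F R -> star F R := smap2 +%R.
Definition smul : star F R -> star F R -> star F R := smap2 *%R.
Definition sopp : star F R -> star F R := smap -%R.
Definition sinv : star F R -> star F R := smap GRing.inv.
Definition snorm : star F R -> star F R := smap Num.norm.
Definition sle x y := `[< \forall i \near uset F, rep x i <= rep y i >].
Definition slt x y := `[< \forall i \near uset F, rep x i < rep y i >].

Local Notation E := (smap2E, smapE).

Fact saddA : associative sadd.
Proof.
elim/(@starW _ F R) => x; elim/(@starW _ F R) => y; elim/(@starW _ F R) => z.
by rewrite /sadd (smap2E F _ y z) (smap2E F _ x y) !E; apply: eq_cls => i; exact: addrA.
Qed.

Fact saddC : commutative sadd.
Proof.
elim/(@starW _ F R) => x; elim/(@starW _ F R) => y.
by rewrite /sadd !E; apply: eq_cls => i; rewrite addrC.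
Qed.

Fact sadd0 : left_id (std F 0) sadd.
Proof.
by elim/(@starW _ F R) => x; rewrite /sadd !E; apply: eq_cls => i; rewrite add0r.
Qed.

Fact saddN : left_inverse (std F 0) sopp sadd.
Proof.
elim/(@starW _ F R) => x; rewrite /sadd /sopp smapE !E.
by apply: eq_cls => i; rewrite addNr.
Qed.

HB.instance Definition _ :=
  GRing.isZmodule.Build (star F R) saddA saddC sadd0 saddN.

Fact smulA : associative smul.
Proof.
elim/(@starW _ F R) => x; elim/(@starW _ F R) => y; elim/(@starW _ F R) => z.
by rewrite /smul (smap2E F _ y z) (smap2E F _ x y) !E; apply: eq_cls => i; exact: mulrA.
Qed.

Fact smulC : commutative smul.
Proof.
elim/(@starW _ F R) => x; elim/(@starW _ F R) => y.
by rewrite /smul !E; apply: eq_cls => i; rewrite mulrC.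
Qed.

Fact smul1 : left_id (std F 1) smul.
Proof.
by elim/(@starW _ F R) => x; rewrite /smul !E; apply: eq_cls => i; rewrite mul1r.
Qed.

Fact smulDl : left_distributive smul sadd.
Proof.
elim/(@starW _ F R) => x; elim/(@starW _ F R) => y; elim/(@starW _ F R) => z.
rewrite /smul /sadd (smap2E F _ x y) (smap2E F _ x z) (smap2E F _ y z) !E.
by apply: eq_cls => i; exact: mulrDl.
Qed.

Fact s1_neq0 : std F (1 : R) != std F 0.
Proof.
by apply/eqP => /clsP/filter_ex[i] /eqP; rewrite oner_eq0.
Qed.

HB.instance Definition _ := GRing.Zmodule_isComNzRing.Build (star F R)
  smulA smulC smul1 smulDl s1_neq0.

Fact smulV x : x != 0 -> sinv x * x = 1.
Proof.
elim/(@starW _ F R): x => x /eqP/clsP/ultra_not x0.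
have -> : sinv (cls F x) * cls F x = cls F (fun i => (x i)^-1 * x i).
  by rewrite [LHS]/(smul _ _) /smul /sinv smapE smap2E.
by apply/clsP; apply: filterS x0 => i /eqP x0; rewrite mulVf.
Qed.

Fact sinv0 : sinv 0 = 0.
Proof. by rewrite [LHS]smapE invr0. Qed.

HB.instance Definition _ := GRing.ComNzRing_isField.Build (star F R) smulV sinv0.

Fact sleE (x y : I -> R) :
  sle (cls F x) (cls F y) <-> \forall i \near uset F, x i <= y i.
Proof.
split=> [/asboolP|]; last (move=> h; apply/asboolP; move: h);
  by move: (rep_cls F x) (rep_cls F y); apply: filterS3 => i -> ->.
Qed.

Fact sltE (x y : I -> R) :
  slt (cls F x) (cls F y) <-> \forall i \near uset F, x i < y i.
Proof.
split=> [/asboolP|]; last (move=> h; apply/asboolP; move: h);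
  by move: (rep_cls F x) (rep_cls F y); apply: filterS3 => i -> ->.
Qed.

Fact sle0_add x y : sle 0 x -> sle 0 y -> sle 0 (x + y).
Proof.
elim/(@starW _ F R): x => x; elim/(@starW _ F R): y => y /sleE x0 /sleE y0.
rewrite [_ + _]smap2E; apply/sleE; move: x0 y0; apply: filterS2 => i.
exact: addr_ge0.
Qed.

Fact sle0_mul x y : sle 0 x -> sle 0 y -> sle 0 (x * y).
Proof.
elim/(@starW _ F R): x => x; elim/(@starW _ F R): y => y /sleE x0 /sleE y0.
rewrite [_ * _]smap2E; apply/sleE; move: x0 y0; apply: filterS2 => i.
exact: mulr_ge0.
Qed.

Fact sle0_anti x : sle 0 x -> sle x 0 -> x = 0.
Proof.
elim/(@starW _ F R): x => x /sleE x0 /sleE x0'; apply/clsP.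
by move: x0 x0'; apply: filterS2 => i x0 x0'; apply/eqP; rewrite eq_le x0'.
Qed.

Fact ssub_ge0 x y : sle 0 (y - x) = sle x y.
Proof.
elim/(@starW _ F R): x => x; elim/(@starW _ F R): y => y.
have -> : cls F y - cls F x = cls F (fun i => y i - x i).
  by rewrite [LHS]/(sadd _ (sopp _)) /sadd /sopp smapE smap2E.
by apply/idP/idP => /sleE h; apply/sleE; apply: filterS h => i; rewrite subr_ge0.
Qed.

Fact sle0_total x : sle 0 x || sle x 0.
Proof.
elim/(@starW _ F R): x => x; apply/orP.
have /ultra_or[x0|x0] : \forall i \near uset F, 0 <= x i \/ x i <= 0.
- by apply: nearW => i; apply/orP; exact: le_total.
- by left; apply/sleE.
- by right; apply/sleE.
Qed.

Fact snormN x : snorm (- x) = snorm x.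
Proof.
elim/(@starW _ F R): x => x; rewrite [- _]smapE /snorm !smapE.
by apply: eq_cls => i; rewrite normrN.
Qed.

Fact ge0_snorm x : sle 0 x -> snorm x = x.
Proof.
elim/(@starW _ F R): x => x /sleE x0; rewrite /snorm !E; apply/clsP.
by apply: filterS x0 => i; exact: ger0_norm.
Qed.

Fact slt_def x y : slt x y = (y != x) && sle x y.
Proof.
elim/(@starW _ F R): x => x; elim/(@starW _ F R): y => y; apply/idP/andP => [/sltE xy|[yx xy]].
  split; last by apply/sleE; apply: filterS xy => i; exact: ltW.
  apply/eqP => /clsP yx; apply: (near_absurd xy yx) => i xy_i yx_i.
  by move: xy_i; rewrite yx_i ltxx.
move/sleE: xy => xy; move/eqP/clsP/ultra_not: yx => yx; apply/sltE.
by move: xy yx; apply: filterS2 => i xy /eqP yx; rewrite lt_neqAle xy eq_sym yx.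
Qed.

HB.instance Definition _ := Num.IntegralDomain_isLeReal.Build (star F R)
  sle0_add sle0_mul sle0_anti ssub_ge0 sle0_total snormN ge0_snorm slt_def.

Lemma clsD (x y : I -> R) : cls F x + cls F y = cls F (fun i => x i + y i).
Proof. exact: smap2E. Qed.

Lemma clsM (x y : I -> R) : cls F x * cls F y = cls F (fun i => x i * y i).
Proof. exact: smap2E. Qed.

Lemma clsN (x : I -> R) : - cls F x = cls F (fun i => - x i).
Proof. exact: smapE. Qed.

Lemma clsV (x : I -> R) : (cls F x)^-1 = cls F (fun i => (x i)^-1).
Proof. exact: smapE. Qed.

Lemma cls_norm (x : I -> R) : `|cls F x| = cls F (fun i => `|x i|).
Proof. exact: smapE. Qed.

Lemma cls_le (x y : I -> R) :
  cls F x <= cls F y <-> \forall i \near uset F, x i <= y i.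
Proof. exact: sleE. Qed.

Lemma cls_lt (x y : I -> R) :
  cls F x < cls F y <-> \forall i \near uset F, x i < y i.
Proof. exact: sltE. Qed.

Definition limited x := exists M : R, `|x| <= std F M.

Definition infinitesimal x := forall e : R, 0 < e -> `|x| < std F e.

(* The standard part; its value is 0 on unlimited hyperreals. *)
Definition St x : R := xget 0 [set r : R | infinitesimal (x - std F r)].

(* The hypernaturals and hyperintegers, as subsets of the hyperreals. *)
Definition hypernat : set (star F R) :=
  sset (std F [set n%:R | n in [set: nat]]).

Definition hyperint : set (star F R) :=
  sset (std F [set m%:~R | m in [set: int]]).

End Hyperreal.

Section HyperfiniteSum.
Context {I : Type} (F : ultrafilter_on I) (R : realFieldType) (T : choiceType).

(* The sum over the hyperfinite set A of a function f that is internal on A is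
   the transfer of the finite sum, taken at internal representatives of A and f
   (by [hsumE] the choice of representatives is irrelevant).  It is 0 by
   convention when A is not hyperfinite or f is not internal on A. *)
Definition is_hsum (A : set (star F T)) (f : star F T -> star F R)
    (s : star F R) :=
  exists B : star F (set T), exists g : star F (T -> R),
    [/\ A = sset B, sset (std F finite_set) B,
        (forall x, A x -> f x = sfun g x) &
        s = smap2 (fun (D : set T) (h : T -> R) => \sum_(x \in D) h x) B g].

Definition hsum A f : star F R := xget 0 (is_hsum A f).

Lemma is_hsum_unique A f s s' : is_hsum A f s -> is_hsum A f s' -> s = s'.
Proof.
move=> [B [g [-> _ fg ->]]] [B' [g' [/sset_inj <- _ fg' ->]]] {s s' B'}.
move: fg fg'; elim/(@starW _ F (set T)): B => B.
elim/(@starW _ F (T -> R)): g => g; elim/(@starW _ F (T -> R)): g' => g' fg fg'.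
have /sfun_on_inj gg' : forall x, sset (cls F B) x ->
    sfun (cls F g) x = sfun (cls F g') x.
  by move=> x Bx; rewrite -fg// -fg'.
rewrite !smap2E; apply/clsP; apply: filterS gg' => i gg'.
by apply: eq_fsbigr => x /[!inE]; exact: gg'.
Qed.

Lemma hsumE A f s : is_hsum A f s -> hsum A f = s.
Proof.
by move=> As; exact: (is_hsum_unique (xgetPex 0 (ex_intro _ s As)) As).
Qed.

End HyperfiniteSum.

Section Grid.
Context {I : Type} (F : ultrafilter_on I) (R : realType).

Definition gridC (dx dt N : star F R) : set (star F (R * R)) :=
  [set z | exists m n, [/\ hyperint m, hypernat n,
                           `|m| + n <= N & z = spair (m * dx) (n * dt)]].

Lemma gridC_hyperfinite dx dt N : hyperfinite (gridC dx dt N).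
Proof.
elim/(@starW _ F R): dx => dx; elim/(@starW _ F R): dt => dt.
elim/(@starW _ F R): N => N.
pose G i : set (R * R) := [set z | exists (m : int) (n : nat),
  `|m%:~R| + n%:R <= N i /\ z = (m%:~R * dx i, n%:R * dt i)].
exists (cls F G); last first.
  apply/ssetE/nearW => i.
  have [b Nb] : exists b : nat, N i < b%:R.
    by exists (Num.truncn `|N i|).+1; rewrite (le_lt_trans (ler_norm _))// truncnS_gt.
  pose h (p : 'I_b * bool * 'I_b) : R * R :=
    ((if p.1.2 then - (p.1.1 : nat)%:R else (p.1.1 : nat)%:R) * dx i,
     (p.2 : nat)%:R * dt i).
  apply: (@sub_finite_set _ _ (h @` setT)); last exact/finite_image/finite_finset.
  move=> _ [m [n [mnN ->]]].
  have lt_b (k : nat) : k%:R <= N i -> (k < b)%N.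
    by move=> kN; rewrite -(ltr_nat R); exact: le_lt_trans kN Nb.
  have nb : (n < b)%N.
    by apply: lt_b; apply: le_trans mnN; rewrite lerDr.
  have mb : (`|m| < b)%N.
    apply: lt_b; rewrite natr_absz intr_norm; apply: le_trans mnN.
    by rewrite lerDl.
  exists (Ordinal mb, m < 0, Ordinal nb) => //; rewrite /h/=.
  by case: ifPn => m0; congr (_ * _, _);
    rewrite natr_absz intr_norm; [rewrite ltr0_norm ?ltrz0// opprK|
    rewrite ger0_norm// ler0z leNgt].
apply/seteqP; split=> [z [m [n []]]|].
  elim/(@starW _ F R): m => m; elim/(@starW _ F R): n => n.
  move=> /ssetE mZ /ssetE nN.
  rewrite cls_norm clsD => /cls_le mnN ->; rewrite !clsM /spair smap2E; apply/ssetE.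
  move: mZ nN mnN; apply: filterS3 => i [a _ <-] [b _ <-] ab.
  by exists a, b.
elim/(@starW _ F (R * R)%type) => z /ssetE Gz.
have [m mP] : exists m : I -> int, \forall i \near uset F, exists n : nat,
    `|(m i)%:~R| + n%:R <= N i /\ z i = ((m i)%:~R * dx i, n%:R * dt i).
  exact: near_choice Gz.
have [n nP] := near_choice mP.
exists (cls F (fun i => (m i)%:~R)), (cls F (fun i => (n i)%:R)); split.
- by apply/ssetE/nearW => i; exists (m i).
- by apply/ssetE/nearW => i; exists (n i).
- by rewrite cls_norm clsD; apply/cls_le; apply: filterS nP => i [].
- by rewrite !clsM /spair smap2E; apply/clsP; apply: filterS nP => i [].
Qed.

End Grid.

Section TestFunctions.
Context (R : realType).
Local Notation plane := (R * R)%type.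

(* The coordinates of the plane are (x, t): [false] stands for x, [true] for t. *)
Definition coord (b : bool) : plane := if b then (0, 1) else (1, 0).

Definition partial (b : bool) (f : plane -> R) : plane -> R :=
  fun z => 'D_(coord b) f z.

Definition partials (s : seq bool) (f : plane -> R) : plane -> R :=
  foldr partial f s.

Definition smooth (f : plane -> R) := forall s : seq bool,
  continuous (partials s f) /\
  forall b z, derivable (partials s f) z (coord b).

Definition supp (f : plane -> R) : set plane := closure [set z | f z != 0].

Definition test_pred : {pred plane -> R} :=
  [pred f | `[< smooth f /\ compact (supp f) >]].

Lemma test_predP f : f \in test_pred <-> smooth f /\ compact (supp f).
Proof. by split=> [/asboolP|fP]; [|exact/asboolP]. Qed.

Lemma partialsD s f g : smooth f -> smooth g ->
  partials s (f + g) = partials s f + partials s g.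
Proof.
move=> sf sg; elim: s => //= b s ->; apply/funext => z.
by rewrite /partial deriveD//; [exact: (sf s).2|exact: (sg s).2].
Qed.

Lemma partialsZ s a f : smooth f ->
  partials s (a *: f) = a *: partials s f.
Proof.
move=> sf; elim: s => //= b s ->; apply/funext => z.
by rewrite /partial deriveZ//; exact: (sf s).2.
Qed.

Lemma partials0 s : partials s 0 = 0.
Proof.
by elim: s => //= b s ->; apply/funext => z; exact: derive_cst.
Qed.

Lemma suppNE f z : ~ supp f z -> \forall y \near z, f y = 0.
Proof.
move=> /existsNP[A /not_implyP[zA /set0P/negP/negPn/eqP fA]].
apply: filterS zA => y Ay; apply/eqP/negPn/negP => fy.
by have : set0 y by rewrite -fA.
Qed.

Fact test_submod_closed : submod_closed test_pred.
Proof.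
split.
  apply/test_predP; split; first by move=> s; rewrite partials0; split;
    [exact: cst_continuous|move=> b z; exact: derivable_cst].
  rewrite /supp (_ : [set _ | _] = set0) ?closure0; first exact: compact0.
  by apply/seteqP; split => // z /=; rewrite eqxx.
move=> a f g /test_predP[sf cf] /test_predP[sg cg]; apply/test_predP.
have saf : smooth (a *: f).
  move=> s; rewrite partialsZ//; split=> [z|b z].
    by apply: continuousZl_tmp; exact: (sf s).1.
  by apply: derivableZ; exact: (sf s).2.
split.
  move=> s; rewrite partialsD//; split=> [z|b z].
    by apply: continuousD; [exact: (saf s).1|exact: (sg s).1].
  by apply: derivableD; [exact: (saf s).2|exact: (sg s).2].
apply: (subclosed_compact _ (compactU cf cg)); first exact: closed_closure.
rewrite /supp -closureU; apply: closureS => z /=; apply: contraPP.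
move=> /not_orP[/negP/negPn/eqP fz /negP/negPn/eqP gz]; apply/negP/negPn/eqP.
by rewrite -[LHS]/(a *: f z + g z) fz gz scaler0 addr0.
Qed.

HB.instance Definition _ :=
  GRing.isSubmodClosed.Build R (plane -> R) test_pred test_submod_closed.

Record testfun := TestFun {
  testfun_val :> plane -> R;
  testfun_prop : testfun_val \in test_pred
}.

HB.instance Definition _ := [isSub for testfun_val].
HB.instance Definition _ := [Choice of testfun by <:].
HB.instance Definition _ := [SubChoice_isSubLmodule of testfun by <:].

Lemma testfun_smooth (f : testfun) : smooth f.
Proof. by have /test_predP[] := testfun_prop f. Qed.

Lemma testfun_compact (f : testfun) : compact (supp f).
Proof. by have /test_predP[] := testfun_prop f. Qed.
Arguments testfun_compact : clear implicits.

Fact partial_test b (f : testfun) : partial b f \in test_pred.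
Proof.
apply/test_predP; split=> [s|].
  by have := testfun_smooth f (rcons s b); rewrite /partials foldr_rcons.
apply: (subclosed_compact _ (testfun_compact f)); first exact: closed_closure.
have /closure_id sfE : closed (supp f) by exact: closed_closure.
rewrite [X in _ `<=` X]sfE.
apply: closureS => z; apply: contraPP => /suppNE fz; apply/negP/negPn/eqP.
rewrite /partial (near_eq_derive (coord b) (_ : \forall y \near z, f y = cst 0 y))//.
exact: derive_cst.
Qed.

Definition d_x (f : testfun) : testfun := TestFun (partial_test false f).
Definition d_t (f : testfun) : testfun := TestFun (partial_test true f).

(* The usual topology of the space of test functions: the inductive limit of the
   Frechet spaces of the test functions supported in a compact set K, each with
   the topology given by the seminorms sup |partials s f|.  A base of
   neighbourhoods of 0 is given by the convex balanced sets that meet each of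
   these spaces in an open set. *)
Definition open_in_DK (K : set plane) (W : set testfun) :=
  forall f, W f -> supp f `<=` K ->
  exists (m : nat) (e : R), 0 < e /\
    forall g : testfun, supp g `<=` K ->
      (forall s z, (size s <= m)%N -> `|partials s g z - partials s f z| < e) ->
      W g.

Definition nbhs0_base (W : set testfun) :=
  [/\ W 0,
      convex_set (W : set (convex_lmodType testfun)),
      (forall (a : R) f, `|a| <= 1 -> W f -> W (a *: f)) &
      forall K, compact K -> open_in_DK K W].

Definition open_test (O : set testfun) :=
  forall f, O f -> exists2 W, nbhs0_base W & forall g, W (g - f) -> O g.

Fact open_testT : open_test setT.
Proof. by move=> f _; exists setT => //; split => // K _ f' _ _; exists 0%N, 1. Qed.

Fact open_testI : setI_closed open_test.
Proof.
move=> O O' oO oO' f [/oO[W [W0 cW bW oW] WO] /oO'[W' [W'0 cW' bW' oW'] WO']].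
exists (W `&` W') => [|g [/WO Og /WO' O'g]//]; split => //.
- move=> g h l; rewrite !in_setI => /andP[gW gW'] /andP[hW hW'].
  by rewrite cW// cW'.
- by move=> a g a1 [Wg W'g]; split; [exact: bW|exact: bW'].
- move=> K cK g [Wg W'g] gK.
  have [m [e [e0 me]]] := oW K cK g Wg gK.
  have [m' [e' [e'0 me']]] := oW' K cK g W'g gK.
  exists (maxn m m'), (Num.min e e'); split; first by rewrite lt_min e0.
  move=> h hK hg; split; [apply: me|apply: me'] => // s z sm;
    have := hg s z; rewrite leq_max sm ?orbT lt_min => /(_ isT)/andP[//].
Qed.

Fact open_test_bigU (J : Type) (O : J -> set testfun) :
  (forall j, open_test (O j)) -> open_test (\bigcup_j O j).
Proof.
move=> oO f [j _ /oO[W W0 WO]]; exists W => // g /WO Og; by exists j.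
Qed.

HB.instance Definition _ :=
  isOpenTopological.Build testfun open_testT open_testI open_test_bigU.

Definition is_distribution (u : testfun -> R) := scalar u /\ continuous u.

End TestFunctions.

(* Main.v *)
(** Under the CFL condition alpha <= 1/2 each time step of the scheme is a
    convex combination, so [|U| <= sup |u0|] on the whole grid.  Tested against
    [phi], the grid sums are therefore bounded by [C sup |phi|] with [C] depending
    only on the support of [phi], which gives both limitedness and continuity.
    Summation by parts moves the difference quotients from [U] to [phi] exactly,
    leaving only the initial sum [sum_m u0(m dx) phi(m dx, 0) dx], a Riemann sum
    of the right-hand side; replacing difference quotients of [phi] by
    derivatives costs [O(dx + dt)].  All of this is done at each index of the
    ultrapower, where the standard part becomes a limit along the ultrafilter. *)

Require Import Defs.
From mathcomp Require Import all_boot all_order all_algebra.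
From mathcomp Require Import all_classical all_reals all_analysis.
From mathcomp Require Import ring lra zify.
Set Implicit Arguments.
Unset Strict Implicit.
Unset Printing Implicit Defensive.
Import Order.TTheory GRing.Theory Num.Theory numFieldNormedType.Exports.
Local Open Scope classical_set_scope.
Local Open Scope ring_scope.

(** * Difference quotients of test functions *)

(** The moving coordinate [s] runs along direction [b] while [r] is frozen, so one-variable calculus
    serves space and time at once. *)
Definition axis_pt {R : realType} (b : bool) (r s : R) : R * R :=
  if b then (r, s) else (s, r).

(** Staying inside [testfun] lets derivatives be iterated and bounded; at [false] and [true] it is
    convertible to [d_x] and [d_t]. *)
Definition test_partial {R : realType} (b : bool) (f : testfun R) : testfun R :=
  TestFun (partial_test b f).

(** The slice and the directional derivative have literally the same difference quotient. The shift
    [h] is built in so that second differences can be differentiated without a chain rule. *)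
Lemma is_derive_axis (R : realType) (f : testfun R) b (r h s : R) :
  is_derive s 1 (fun s => f (axis_pt b r (s + h)))
    (test_partial b f (axis_pt b r (s + h))).
Proof.
have [_ /(_ b (axis_pt b r (s + h))) df] := testfun_smooth f [::].
have E : (fun e : R => e^-1 *: (f (axis_pt b r (e *: 1 + s + h)) -
    f (axis_pt b r (s + h)))) =
  (fun e : R => e^-1 *: (f (e *: Defs.coord R b + axis_pt b r (s + h)) -
    f (axis_pt b r (s + h)))).
  apply/funext => e; congr (_ *: (f _ - _)); rewrite -addrA.
  by case: b {df} => /=; congr (_, _); rewrite /= ?scaler0 ?add0r.
apply: DeriveDef; last by rewrite /test_partial/= /partial /derive /= E.
by rewrite /derivable /= E; exact: df.
Qed.

Lemma is_derive_axis0 (R : realType) (f : testfun R) b (r s : R) :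
  is_derive s 1 (fun s => f (axis_pt b r s)) (test_partial b f (axis_pt b r s)).
Proof.
have := is_derive_axis f b r 0 s; rewrite addr0.
by under eq_fun do rewrite addr0.
Qed.

Lemma derive_continuous (R : realType) (f df : R -> R) :
  (forall x : R, is_derive x 1 f (df x)) -> continuous f.
Proof.
move=> fdf x; apply/differentiable_continuous/derivable1_diffP.
by have [] := fdf x.
Qed.

Lemma MVT_global (R : realType) (f df : R -> R) (a b : R) : a <= b ->
  (forall x : R, is_derive x 1 f (df x)) ->
  exists2 c, a <= c <= b & f b - f a = df c * (b - a).
Proof.
move=> ab fdf; have [|c cab ->] := @MVT_segment R f df a b ab (fun x _ => fdf x).
  exact/continuous_subspaceT/(derive_continuous fdf).
by exists c.
Qed.

Lemma test_lipschitz (R : realType) (f : testfun R) b (C r s s' : R) :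
  (forall z, `|test_partial b f z| <= C) ->
  `|f (axis_pt b r s') - f (axis_pt b r s)| <= C * `|s' - s|.
Proof.
move=> fC; wlog ss' : s s' / s <= s' => [hw|].
  by case: (leP s s') => [/hw //|/ltW/hw]; rewrite distrC (distrC s).
have [c _ ->] := MVT_global ss' (is_derive_axis0 f b r).
by rewrite normrM ler_wpM2r.
Qed.

(** The mean value theorem turns the quotient into the derivative at some [c] in [[s, s + h]], at
    distance at most [h] from the right end. Comparing at the right end makes this a backward
    quotient. *)
Lemma first_difference_bound (R : realType) (f : testfun R) b (C r s h : R) :
  (forall z, `|test_partial b (test_partial b f) z| <= C) -> 0 < h ->
  `|(f (axis_pt b r (s + h)) - f (axis_pt b r s)) / h -
    test_partial b f (axis_pt b r (s + h))| <= C * h.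
Proof.
move=> fC h0; have ssh : s <= s + h by rewrite lerDl ltW.
have [c /andP[sc csh] ->] := MVT_global ssh (is_derive_axis0 f b r).
rewrite (addrC s) addrK mulfK ?gt_eqF//.
apply: le_trans (test_lipschitz _ _ _ fC) _.
(* The constant [C] is nonnegative because it bounds a norm at some point; [(r, r)] is an arbitrary
   choice. *)
rewrite ler_wpM2l//; first exact: le_trans (fC (r, r)).
by rewrite ler0_norm; lra.
Qed.

(** The second difference is the increment over [[s - h, s]] of the first difference, so two uses of
    the mean value theorem give [h ^+ 2] times the second derivative at some [d] within [h] of [s].
    An error of first order in [h] suffices, hence three derivatives do. *)
Lemma second_difference_bound (R : realType) (f : testfun R) b (C r s h : R) :
  (forall z, `|test_partial b (test_partial b (test_partial b f)) z| <= C) ->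
  0 < h ->
  `|(f (axis_pt b r (s + h)) - 2 * f (axis_pt b r s) + f (axis_pt b r (s - h)))
      / h ^+ 2 - test_partial b (test_partial b f) (axis_pt b r s)| <= C * h.
Proof.
move=> fC h0; have shs : s - h <= s by lra.
have df (x : R) : is_derive x 1
    (fun s => f (axis_pt b r (s + h)) - f (axis_pt b r s))
    (test_partial b f (axis_pt b r (x + h)) - test_partial b f (axis_pt b r x)).
  by apply: is_deriveB; [exact: is_derive_axis|exact: is_derive_axis0].
have [c /andP[sc cs]] := MVT_global shs df.
rewrite /= subrK subKr.
have cch : c <= c + h by rewrite lerDl ltW.
have [d /andP[cd dch] ->] := MVT_global cch (is_derive_axis0 (test_partial b f) b r).
rewrite (addrC c) addrK => E.
have -> : f (axis_pt b r (s + h)) - 2 * f (axis_pt b r s) + f (axis_pt b r (s - h))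
  = test_partial b (test_partial b f) (axis_pt b r d) * h ^+ 2 by lra.
rewrite mulfK ?expf_neq0 ?gt_eqF//.
apply: le_trans (test_lipschitz _ _ _ fC) _.
rewrite ler_wpM2l//; first exact: le_trans (fC (r, r)).
by rewrite ler_norml; lra.
Qed.

(** * Bounds and supports of test functions *)

Lemma testfun_continuous (R : realType) (f : testfun R) : continuous f.
Proof. by have [] := testfun_smooth f [::]. Qed.

Lemma testfun_bounded (R : realType) (f : testfun R) :
  exists C, forall z, `|f z| <= C.
Proof.
have /compact_bounded[M [_ fM]] := continuous_compact
  (continuous_subspaceT (@testfun_continuous R f)) (testfun_compact (f:=f)).
exists (`|M| + 1) => z; have [fz|fz] := eqVneq (f z) 0.
  by rewrite fz normr0; have := normr_ge0 M; lra.
apply: fM; first by have := ler_norm M; lra.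
by exists z => //; exact: subset_closure.
Qed.

Definition vanishes_off_square {R : realType} (A : R) (f : R * R -> R) :=
  forall x t, (A < `|x|) || (A < `|t|) -> f (x, t) = 0.

(** One [A] serves every function supported in [K]; the continuity of the distribution rests on this
    uniformity. *)
Lemma compact_square (R : realType) (K : set (R * R)) : compact K ->
  exists2 A : R, 0 < A &
    forall f : R * R -> R, supp f `<=` K -> vanishes_off_square A f.
Proof.
move=> /compact_bounded[M [_ KM]]; exists (`|M| + 1) => [|f fK x t xt].
  by have := normr_ge0 M; lra.
apply/eqP/negPn/negP => fxt.
have /fK/KM : supp f (x, t) by apply: subset_closure.
move=> /(_ (`|M| + 1)); have MM : M < `|M| + 1 by have := ler_norm M; lra.
move=> /(_ MM)/=; rewrite prod_normE/= ge_max => /andP[x1 t1].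
by case/orP: xt; rewrite ltNge ?x1 ?t1.
Qed.
(** * Discrete estimates *)

Lemma telescope_ord (V : zmodType) (f : nat -> V) n :
  \sum_(i < n) (f i.+1 - f i) = f n - f 0.
Proof. by rewrite -(big_mkord xpredT (fun i => f i.+1 - f i)) telescope_sumr. Qed.

(** Summation by parts in both variables: the equation for [a] trades time differences for space
    differences, the latter move onto [b], and the product [a * b] then telescopes in time down to
    its initial value. Two zero columns are required at each end because the boundary terms in space
    pair neighbouring columns. *)
Lemma discrete_green (R : fieldType) (a b : nat -> nat -> R) (dx dt : R) (J L : nat) :
  dx != 0 -> dt != 0 ->
  (forall j n, (j < J)%N -> (n < L)%N ->
    (a j.+1 n.+1 - a j.+1 n) / dt =
    (a j.+2 n - 2 * a j.+1 n + a j n) / dx ^+ 2) ->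
  (forall n, b 0 n = 0) -> (forall n, b 1 n = 0) ->
  (forall n, b J n = 0) -> (forall n, b J.+1 n = 0) ->
  (forall j, b j L = 0) ->
  \sum_(j < J) \sum_(n < L)
      (a j.+1 n.+1 * ((b j.+1 n.+1 - b j.+1 n) / dt) +
       a j.+1 n * ((b j.+2 n - 2 * b j.+1 n + b j n) / dx ^+ 2)) * dt =
  - \sum_(j < J) a j.+1 0 * b j.+1 0.
Proof.
move=> dx0 dt0 eqn b0 b1 bJ bJ1 bL.
have space n : \sum_(j < J) a j.+1 n * (b j.+2 n - 2 * b j.+1 n + b j n) =
    \sum_(j < J) (a j.+2 n - 2 * a j.+1 n + a j n) * b j.+1 n.
  (* The discrete Wronskian of [a] and [b] in space vanishes at both ends. *)
  pose W j := a j n * b j.+1 n - a j.+1 n * b j n.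
  apply/eqP; rewrite -subr_eq0 -sumrB.
  rewrite (eq_bigr (fun j : 'I_J => W j.+1 - W j)); last by move=> j _; rewrite /W; ring.
  by rewrite telescope_ord /W b0 b1 bJ bJ1 !mulr0 !subr0.
rewrite exchange_big/=.
pose T j n := a j.+1 n * b j.+1 n.
rewrite (eq_bigr (fun n : 'I_L => \sum_(j < J) (T j n.+1 - T j n))); last first.
  move=> n _.
  transitivity (\sum_(j < J) a j.+1 n.+1 * (b j.+1 n.+1 - b j.+1 n) +
      (\sum_(j < J) a j.+1 n * (b j.+2 n - 2 * b j.+1 n + b j n)) / dx ^+ 2 * dt).
    by rewrite !mulr_suml -big_split/=; apply: eq_bigr => j _; field; rewrite dx0.
  (* With the second difference back on [a], the equation makes it a time difference, which
     completes the discrete product rule for [T]. *)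
  rewrite space !mulr_suml -big_split/=.
  apply: eq_bigr => j _ /=.
  by rewrite [X in _ + X * dt]mulrAC -eqn// /T; field.
rewrite exchange_big/= -sumrN; apply: eq_bigr => j _.
by rewrite telescope_ord /T bL mulr0 sub0r.
Qed.

Lemma ler_norm_sum_ord (R : numDomainType) n (F : nat -> R) (C : R) :
  (forall j, (j < n)%N -> `|F j| <= C) -> `|\sum_(j < n) F j| <= n%:R * C.
Proof.
move=> FC; apply: le_trans (ler_norm_sum _ _ _) _.
apply: le_trans (ler_sum _ (fun j _ => FC _ (ltn_ord j))) _.
by rewrite sumr_const card_ord mulr_natl.
Qed.

(* [p] and [q] play the role of the values of [phi_t] and [phi_xx] at the grid
   points.  The backward quotient in time needs no grid point at negative time;
   the shift by one step that it causes is the last term of the bound. *)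
Lemma discrete_weak_form (R : realFieldType) (a b p q : nat -> nat -> R)
    (dx dt M P e1 e2 : R) (J L : nat) :
  0 < dx -> 0 < dt ->
  (forall j n, (j < J)%N -> (n < L)%N ->
    (a j.+1 n.+1 - a j.+1 n) / dt =
    (a j.+2 n - 2 * a j.+1 n + a j n) / dx ^+ 2) ->
  (forall n, b 0 n = 0) -> (forall n, b 1 n = 0) ->
  (forall n, b J n = 0) -> (forall n, b J.+1 n = 0) ->
  (forall j, b j L = 0) -> (forall j, p j L = 0) ->
  (forall j n, (j < J)%N -> (n <= L)%N -> `|a j.+1 n| <= M) ->
  (forall j n, `|(b j n.+1 - b j n) / dt - p j n.+1| <= e1) ->
  (forall j n, `|(b j.+2 n - 2 * b j.+1 n + b j n) / dx ^+ 2 - q j.+1 n| <= e2) ->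
  (forall j, `|p j 0| <= P) ->
  `|(\sum_(j < J) \sum_(n < L) a j.+1 n * (- p j.+1 n - q j.+1 n)) * dx * dt -
    (\sum_(j < J) a j.+1 0 * b j.+1 0) * dx| <=
  (J%:R * dx) * (L%:R * dt) * (M * (e1 + e2)) + (J%:R * dx) * (M * P) * dt.
Proof.
move=> dx0 dt0 eqn b0 b1 bJ bJ1 bL pL aM be1 be2 pP.
(* [E] gathers the consistency errors in time and space; [S2] below is the price of shifting [p] by
   one time step. *)
pose E j n := a j.+1 n.+1 * ((b j.+1 n.+1 - b j.+1 n) / dt - p j.+1 n.+1) +
   a j.+1 n * ((b j.+2 n - 2 * b j.+1 n + b j n) / dx ^+ 2 - q j.+1 n).
pose S1 := \sum_(j < J) \sum_(n < L) E j n.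
pose S2 := \sum_(j < J) a j.+1 0 * p j.+1 0.
have := discrete_green (lt0r_neq0 dx0) (lt0r_neq0 dt0) eqn b0 b1 bJ bJ1 bL.
set GG := \sum_(j < J) _ => EGG.
have -> : (\sum_(j < J) \sum_(n < L) a j.+1 n * (- p j.+1 n - q j.+1 n)) * dx * dt -
    (\sum_(j < J) a j.+1 0 * b j.+1 0) * dx = (S1 * dt - S2 * dt) * dx.
  rewrite mulrAC -mulrBl -EGG; congr (_ * _).
  rewrite /S1 /S2 /GG !mulr_suml -sumrN -!big_split/=; apply: eq_bigr => j _.
  (* Shifting [n] to [n.+1] in the sum of [a * p] costs only the term at time 0, since [p] vanishes
     at level [L]. *)
  have -> : a j.+1 0 * p j.+1 0 =
     - \sum_(n < L) (a j.+1 n.+1 * p j.+1 n.+1 - a j.+1 n * p j.+1 n).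
    by rewrite (telescope_ord (fun n => a j.+1 n * p j.+1 n)) pL mulr0 sub0r opprK.
  rewrite mulNr opprK !mulr_suml -!big_split/=; apply: eq_bigr => n _.
  by rewrite /E; ring.
have S1le : `|S1| <= J%:R * (L%:R * (M * (e1 + e2))).
  apply: (ler_norm_sum_ord (F := fun j => \sum_(n < L) E j n)) => j jJ.
  apply: (ler_norm_sum_ord (F := E j)) => n nL.
  rewrite /E (mulrDr M); apply: le_trans (ler_normD _ _) _; rewrite !normrM.
  by apply: lerD; apply: ler_pM => //; apply: aM => //; exact: ltnW.
have S2le : `|S2| <= J%:R * (M * P).
  apply: (ler_norm_sum_ord (F := fun j => a j.+1 0 * p j.+1 0)) => j jJ.
  by rewrite normrM; apply: ler_pM => //; exact: aM.
rewrite -mulrBl -(mulrA (S1 - S2)) normrM (ger0_norm (x := dt * dx)); last by rewrite mulr_ge0 ?ltW.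
have -> : J%:R * dx * (L%:R * dt) * (M * (e1 + e2)) + J%:R * dx * (M * P) * dt =
  (J%:R * (L%:R * (M * (e1 + e2))) + J%:R * (M * P)) * (dt * dx) by ring.
apply: ler_wpM2r; first by rewrite mulr_ge0 ?ltW.
by apply: le_trans (ler_normB _ _) _; exact: lerD.
Qed.

(** The new value is a combination of three old ones with weights [1 - 2 * c], [c], [c], nonnegative
    by the CFL condition and of sum 1. The three points stay in the triangle, since going back one
    time step pays for one step sideways. *)
Lemma max_principle (R : realFieldType) (w : int -> nat -> R) (dx dt M : R) (N : nat) :
  0 < dx -> 0 < dt -> dt / dx ^+ 2 <= 1 / 2 ->
  (forall m : int, (`|m| <= N)%N -> `|w m 0%N| <= M) ->
  (forall (m : int) n, (`|m| + n < N)%N ->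
    (w m n.+1 - w m n) / dt = (w (m + 1) n - 2 * w m n + w (m - 1) n) / dx ^+ 2) ->
  forall n (m : int), (`|m| + n <= N)%N -> `|w m n| <= M.
Proof.
move=> dx0 dt0 al w0 eqn; elim=> [|n IH] m mn; first by apply: w0; lia.
have := eqn m n; set c := dt / dx ^+ 2 in al *.
have c0 : 0 <= c by rewrite divr_ge0 ?exprn_ge0 ?ltW.
have -> // : (`|m| + n < N)%N by lia.
move=> /(_ isT) E.
have {E} -> : w m n.+1 = (1 - 2 * c) * w m n + c * w (m + 1) n + c * w (m - 1) n.
  have -> : w m n.+1 = w m n + dt * ((w m n.+1 - w m n) / dt).
    by field; rewrite gt_eqF.
  by rewrite E /c; field; rewrite gt_eqF.
have h0 : `|w m n| <= M by apply: IH; lia.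
have h1 : `|w (m + 1) n| <= M by apply: IH; lia.
have h2 : `|w (m - 1) n| <= M by apply: IH; lia.
have d0 : 0 <= 1 - 2 * c by lra.
have -> : M = (1 - 2 * c) * M + c * M + c * M by ring.
apply: le_trans (ler_normD _ _) (lerD _ _);
  first apply: le_trans (ler_normD _ _) (lerD _ _);
  by rewrite normrM ?(ger0_norm d0) ?(ger0_norm c0) ler_wpM2l.
Qed.
(** * Riemann sums *)

(** Joint continuity of [g (x + h) - g x] at [(x, 0)] is made uniform over [K] by near-covering
    compactness; [x + h] may leave [K]. *)
Lemma continuous_compact_uniform (R : realType) (g : R -> R) (K : set R) (e : R) :
  continuous g -> compact K -> 0 < e ->
  \forall h \near (0 : R), forall x, K x -> `|g (x + h) - g x| < e.
Proof.
move=> cg /compact_near_coveringP/(_ R (nbhs (0:R))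
  (fun h x => `|g (x + h) - g x| < e)) cK e0.
apply: cK => x Kx.
have cf : (fun z : R * R => g (z.1 + z.2) - g z.1) @ (x, 0 : R) --> g (x + 0) - g x.
  apply: (@cvgB _ _ _ _ _ (fun z : R * R => g (z.1 + z.2)) (fun z => g z.1)).
    apply: (@continuous_cvg _ _ _ _ _ (fun z : R * R => z.1 + z.2) g); first exact: cg.
    apply: (@cvgD _ _ _ _ _ fst snd); [exact: cvg_fst|exact: cvg_snd].
  apply: (@continuous_cvg _ _ _ _ _ fst g); [exact: cg|exact: cvg_fst].
by move: cf; rewrite addr0 subrr => /cvgrPdist_lt => /(_ e e0);
  apply: filterS => z/=; rewrite sub0r normrN.
Qed.

(** This makes the integral over the line a difference of two values of [G], which can be telescoped
    along a mesh. *)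
Lemma antiderivative_compact_support (R : realType) (g : R -> R) (A : R) :
  continuous g -> (forall x, A < `|x| -> g x = 0) ->
  exists G : R -> R, [/\ forall x : R, is_derive x 1 G (g x),
    forall x, x < - A -> G x = 0 &
    forall x, A < x -> G x = \int[lebesgue_measure]_y g y].
Proof.
move=> cg gA.
have gE : g = g \_ `[- A, A].
  apply/funext => x; rewrite patchE; case: ifPn => // xA; apply: gA.
  by rewrite ltNge ler_norml; move: xA; rewrite notin_setE/= in_itv/=; move/negP.
have ig : lebesgue_measure.-integrable setT (EFin \o g).
  have : lebesgue_measure.-integrable `[- A, A] (EFin \o g).
    apply: continuous_compact_integrable; first exact: segment_compact.
    exact: continuous_subspaceT.
  have mk := iffLR (integrable_mkcond (mu := lebesgue_measure) (EFin \o g)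
    (measurable_itv `[- A, A])).
  by move=> /mk; rewrite restrict_EFin -gE.
exists (fun x => \int[lebesgue_measure]_(t in `]-oo, x]) g t); split.
- move=> x.
  have xx : x < x + 1 by rewrite ltrDl.
  have [||d1 d2] := @continuous_FTC1 R g -oo%O x (x + 1) xx _ _ (cg x).
  + by apply: integrableS ig.
  + by rewrite ltNyr.
  by apply: DeriveDef => //; rewrite -derive1E.
- move=> x xA; rewrite (@eq_Rintegral _ _ _ _ _ (cst 0)); last first.
    move=> y; rewrite inE/= in_itv/= => yx; apply: gA.
    by rewrite -normrN (lt_le_trans _ (ler_norm _))//; lra.
  by rewrite Rintegral_cst// mul0r.
- move=> x xA; rewrite Rintegral_mkcond; apply: eq_Rintegral => y _.
  rewrite patchE; case: ifPn => //; rewrite notin_setE/= in_itv/= => /negP.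
  by rewrite -ltNge => xy; rewrite gA// (lt_trans xA)// (lt_le_trans xy)// ler_norm.
Qed.

(** On each cell the increment of an antiderivative is [g c * h], so uniform continuity bounds the
    error by [h * e']. The estimate is uniform in [k] because [k] will vary with the index of the
    ultrapower. *)
Lemma riemann_sum_cvg (R : realType) (g : R -> R) (A e : R) :
  continuous g -> (forall x, A < `|x| -> g x = 0) -> 0 < A -> 0 < e ->
  \forall h \near (0 : R), forall k : nat, 0 < h ->
    A < k%:R * h -> k%:R * h <= A + 1 ->
    `|(\sum_(j < k.*2.+1) g ((j%:R - k%:R) * h)) * h -
      \int[lebesgue_measure]_y g y| <= e.
Proof.
move=> cg gA A0 e0.
have [G [dG G0 GI]] := antiderivative_compact_support cg gA.
(* The cells have total length [k.*2.+1%:R * h], at most [2 * A + 3] as [k%:R * h <= A + 1] and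
   [h < 1]. *)
pose e' := e / (2 * A + 3).
have e'0 : 0 < e' by rewrite divr_gt0//; lra.
have := continuous_compact_uniform cg (@segment_compact R (- (A + 1)) (A + 1)) e'0.
move=> /nbhs_ballP[d /= d0 dg].
apply/nbhs_ballP; exists (Num.min d 1); first by rewrite /= lt_min d0/=.
move=> h; rewrite -ball_normE/= sub0r normrN lt_min => /andP[hd h1] k h0 Ak kA.
rewrite gtr0_norm// in hd h1.
pose X j := (j%:R - k%:R) * h.
(* The mesh starts left of [- A], where [G] is 0, and ends right of [A], where [G] is the whole
   integral. *)
have -> : \int[lebesgue_measure]_y g y =
    \sum_(j < k.*2.+1) (G (X j.+1) - G (X j)).
  rewrite (telescope_ord (fun j => G (X j))) (G0 (X 0)) ?subr0 ?GI//.
    by rewrite /X -addn1 -addnn !natrD; lra.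
  by rewrite /X; lra.
rewrite mulr_suml -sumrB.
have ke : k.*2.+1%:R * (h * e') <= e.
  have -> : e = (2 * A + 3) * e' by rewrite /e'; field; lra.
  rewrite mulrA ler_wpM2r 1?ltW// -addn1 -addnn !natrD; lra.
apply: le_trans ke.
apply: (ler_norm_sum_ord (F := fun j => g (X j) * h - (G (X j.+1) - G (X j)))).
move=> j jk.
have XS : X j.+1 = X j + h by rewrite /X -addn1 natrD; ring.
have XX : X j <= X j.+1 by rewrite XS lerDl ltW.
have [c /andP[c1 c2] ->] := MVT_global XX dG.
rewrite XS (addrC (X j)) addrK -mulrBl normrM mulrC (ger0_norm (ltW h0)).
rewrite ler_wpM2l ?(ltW h0)//.
have -> : c = X j + (c - X j) by ring.
rewrite distrC ltW// dg//=.
  rewrite -ball_normE/= sub0r normrN ger0_norm; lra.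
rewrite in_itv/= -ler_norml /X normrM (ger0_norm (ltW h0)).
apply: le_trans kA; rewrite ler_wpM2r ?(ltW h0)// ler_norml.
have : j%:R <= k%:R + k%:R :> R by rewrite -natrD ler_nat; lia.
by have : 0 <= j%:R :> R by []; lra.
Qed.

(** * The scheme on a standard grid *)

Definition grid {R : realType} (dx dt N : R) : set (R * R) :=
  [set z | exists (m : int) (n : nat),
    `|m%:~R| + n%:R <= N /\ z = (m%:~R * dx, n%:R * dt)].

(** In grid indices the support of [f] lies in a rectangle, which [k + l <= N] places inside the
    triangle; outside it the terms are 0. Column [j] stands for the integer [j - k]. *)
Lemma grid_fsum (R : realType) (f : R * R -> R) (dx dt A N : R) (k l : nat) :
  0 < dx -> 0 < dt -> A < k%:R * dx -> A < l%:R * dt -> (k + l)%:R <= N ->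
  vanishes_off_square A f ->
  \sum_(z \in grid dx dt N) f z =
  \sum_(j < k.*2.+1) \sum_(n < l) f ((j%:R - k%:R) * dx, n%:R * dt).
Proof.
move=> dx0 dt0 Ak Al klN fA.
pose h (p : nat * nat) : R * R := ((p.1%:R - k%:R) * dx, p.2%:R * dt).
have hinj : injective h.
  move=> [j n] [j' n'] [/(mulIf (lt0r_neq0 dx0))/addIr/eqP + /(mulIf (lt0r_neq0 dt0))/eqP].
  by rewrite !eqr_nat => /eqP -> /eqP ->.
transitivity (\sum_(z \in h @` (`I_k.*2.+1 `*` `I_l)) f z).
  apply/esym/fsbig_widen => [_ [[j n] [/= jk nl] <-]|z [[m [n [mnN zE]]] nz]].
    exists ((j : int) - (k : int)), n; split; last by rewrite /h/= intrD intrN.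
    apply: le_trans klN; rewrite intrD intrN natrD lerD ?ler_nat 1?ltnW//.
    rewrite ler_norml -[j%:~R]/(j%:R) -[k%:~R]/(k%:R).
    have : j%:R <= k%:R + k%:R :> R by rewrite -natrD ler_nat; lia.
    by have : 0 <= j%:R :> R by []; lra.
  rewrite zE; apply: fA; apply: contra_notT nz => /norP[].
  rewrite -!leNgt !normrM (gtr0_norm dx0) (gtr0_norm dt0) => mk nl.
  have {}mk : (`|m| < k)%N.
    rewrite -(ltr_nat R) natr_absz intr_norm -(ltr_pM2r dx0); exact: le_lt_trans Ak.
  have {}nl : (n < l)%N.
    rewrite -(ltr_nat R) -(ltr_pM2r dt0); apply: le_lt_trans Al.
    by rewrite -[n%:R]ger0_norm.
  exists (absz (m + k), n); first by split => //=; lia.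
  rewrite /h/= zE; congr (_ * _, _); rewrite natr_absz ger0_norm; last by lia.
  by rewrite intrD addrK.
rewrite fsbig_image; last by move=> ? ? _ _; exact: hinj.
have := @pair_fsbig R 0 _ nat nat `I_k.*2.+1 `I_l (fun j n => f (h (j, n)))
  (finite_II _) (finite_II _).
rewrite /h/= => <-; rewrite -fsbig_ord.
by apply: eq_bigr => j _; rewrite -fsbig_ord.
Qed.

(** The conditions on the internal function [U], read at a single index of the ultrapower. *)
Record heat_scheme {R : realType} (u0 : R -> R) (dx dt : R) (N : nat)
    (U : R * R -> R) : Prop := HeatScheme {
  scheme_dx_gt0 : 0 < dx;
  scheme_dt_gt0 : 0 < dt;
  scheme_cfl : dt / dx ^+ 2 <= 1 / 2;
  scheme_init : forall m : int, (`|m| <= N)%N -> U (m%:~R * dx, 0) = u0 (m%:~R * dx);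
  scheme_step : forall (m : int) (n : nat), (`|m| + n < N)%N ->
    let x := m%:~R * dx in let t := n%:R * dt in
    (U (x, t + dt) - U (x, t)) / dt =
    (U (x + dx, t) - 2 * U (x, t) + U (x - dx, t)) / dx ^+ 2
}.

Lemma heat_scheme_bounded (R : realType) (u0 : R -> R) (M dx dt : R) (N : nat)
    (U : R * R -> R) :
  (forall x, `|u0 x| <= M) -> heat_scheme u0 dx dt N U ->
  forall (m : int) n, (`|m| + n <= N)%N -> `|U (m%:~R * dx, n%:R * dt)| <= M.
Proof.
move=> u0M [dx0 dt0 cfl init step] m n.
apply: (@max_principle R (fun m n => U (m%:~R * dx, n%:R * dt)) dx dt) => //.
  by move=> p pN; rewrite mul0r init.
move=> p q pq; have := step p q pq => /=.
have -> : (p + 1)%:~R * dx = p%:~R * dx + dx by rewrite intrD; ring.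
have -> : (p - 1)%:~R * dx = p%:~R * dx - dx by rewrite intrB; ring.
by have -> : q.+1%:R * dt = q%:R * dt + dt by rewrite -addn1 natrD; ring.
Qed.

(** Each of the [k.*2.+1 * l] terms is at most [M * C * dx * dt]. The lengths [k.*2.+1%:R * dx] and
    [l%:R * dt] are kept as factors since they stay bounded as the mesh shrinks. *)
Lemma grid_sum_bound (R : realType) (u0 : R -> R) (M C dx dt A : R) (N k l : nat)
    (U psi : R * R -> R) :
  (forall x, `|u0 x| <= M) -> heat_scheme u0 dx dt N U ->
  A < k%:R * dx -> A < l%:R * dt -> (k + l <= N)%N ->
  vanishes_off_square A psi -> (forall z, `|psi z| <= C) ->
  `|\sum_(z \in grid dx dt N%:R) (U z * psi z * dx * dt)| <=
  k.*2.+1%:R * dx * (l%:R * dt) * (M * C).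
Proof.
move=> u0M hU Ak Al klN psiA psiC; have [dx0 dt0 _ _ _] := hU.
rewrite (grid_fsum dx0 dt0 Ak Al); last first.
- by move=> x t /psiA ->; rewrite mulr0 !mul0r.
- by rewrite ler_nat.
have -> : k.*2.+1%:R * dx * (l%:R * dt) * (M * C) =
  k.*2.+1%:R * (l%:R * (M * C * dx * dt)) by ring.
pose f (j n : nat) :=
  U ((j%:R - k%:R) * dx, n%:R * dt) * psi ((j%:R - k%:R) * dx, n%:R * dt) * dx * dt.
apply: (ler_norm_sum_ord (F := fun j => \sum_(n < l) f j n)) => j jk.
apply: (ler_norm_sum_ord (F := f j)).
move=> n nl; rewrite /f !normrM (gtr0_norm dx0) (gtr0_norm dt0).
rewrite !(ler_wpM2r (ltW _))// ler_pM//.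
have := heat_scheme_bounded u0M hU (m := j%:Z - k%:Z) (n := n).
by rewrite intrB; apply; lia.
Qed.

Lemma grid_weak_form (R : realType) (u0 : R -> R)
    (M dx dt A Ct Ctt Cxxx : R) (N k l : nat) (U : R * R -> R) (phi : testfun R) :
  (forall x, `|u0 x| <= M) -> heat_scheme u0 dx dt N U ->
  A < k%:R * dx -> A < l%:R * dt -> (k + l <= N)%N ->
  vanishes_off_square A phi -> vanishes_off_square A (d_t phi) ->
  vanishes_off_square A (- d_t phi - d_x (d_x phi) : testfun R) ->
  (forall z, `|d_t phi z| <= Ct) -> (forall z, `|d_t (d_t phi) z| <= Ctt) ->
  (forall z, `|d_x (d_x (d_x phi)) z| <= Cxxx) ->
  `|\sum_(z \in grid dx dt N%:R)
      (U z * (- d_t phi - d_x (d_x phi) : testfun R) z * dx * dt) -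
    (\sum_(j < k.*2.+1) u0 ((j%:R - k%:R) * dx) * phi ((j%:R - k%:R) * dx, 0)) * dx|
  <= k.*2.+1%:R * dx * (l%:R * dt) * (M * (Ctt * dt + Cxxx * dx)) +
     k.*2.+1%:R * dx * (M * Ct) * dt.
Proof.
move=> u0M hU Ak Al klN phiA tphiA vA tC ttC xxxC; have [dx0 dt0 _ init step] := hU.
rewrite (grid_fsum dx0 dt0 Ak Al); last first.
- by move=> x t /vA ->; rewrite mulr0 !mul0r.
- by rewrite ler_nat.
(* The offset [k.+1] makes [Z j.+1] the summation point [(j - k) * dx] and puts columns 0, 1,
   [k.*2.+1] and [k.*2.+2] beyond [A], where [phi] vanishes. *)
pose Z j := (j%:Z - k.+1%:Z)%:~R * dx; pose T n := n%:R * dt.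
have ZS j : Z j.+1 = Z j + dx.
  rewrite /Z (_ : j.+1%:Z - k.+1%:Z = j%:Z - k.+1%:Z + 1); last by lia.
  by rewrite intrD; ring.
have TS n : T n.+1 = T n + dt by rewrite /T -addn1 natrD; ring.
have ZX j : (j%:R - k%:R) * dx = Z j.+1.
  by rewrite /Z (_ : j.+1%:Z - k.+1%:Z = j%:Z - k%:Z) ?intrB//; lia.
have ZA j : (j <= 1)%N || (k.*2 < j)%N -> A < `|Z j|.
  rewrite /Z normrM (gtr0_norm dx0) => jk; apply: lt_le_trans Ak _.
  rewrite ler_wpM2r ?(ltW dx0)// -intr_norm -[k%:R]/(k%:Z%:~R) ler_int; lia.
have b0 j n : (j <= 1)%N || (k.*2 < j)%N -> phi (Z j, T n) = 0.
  by move=> /ZA Zj; rewrite phiA// Zj.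
have Ub (j n : nat) : (j < k.*2.+1)%N -> (n <= l)%N -> `|U (Z j.+1, T n)| <= M.
  move=> jk nl; apply: (heat_scheme_bounded u0M hU); lia.
have -> : (\sum_(j < k.*2.+1) u0 ((j%:R - k%:R) * dx) * phi ((j%:R - k%:R) * dx, 0)) =
   \sum_(j < k.*2.+1) U (Z j.+1, T 0) * phi (Z j.+1, T 0).
  apply: eq_bigr => j _; rewrite ZX /T mul0r init //; have := ltn_ord j; lia.
have Tl : A < `|T l| by apply: lt_le_trans (ler_norm _).
have -> : \sum_(j < k.*2.+1) \sum_(n < l)
     U ((j%:R - k%:R) * dx, n%:R * dt) *
     (- d_t phi - d_x (d_x phi) : testfun R) ((j%:R - k%:R) * dx, n%:R * dt) * dx * dt =
  (\sum_(j < k.*2.+1) \sum_(n < l) U (Z j.+1, T n) *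
     (- d_t phi (Z j.+1, T n) - d_x (d_x phi) (Z j.+1, T n))) * dx * dt.
  rewrite !mulr_suml; apply: eq_bigr => j _; rewrite !mulr_suml; apply: eq_bigr => n _.
  by rewrite ZX.
apply: (discrete_weak_form (a := fun j n => U (Z j, T n)) (b := fun j n => phi (Z j, T n))
  (p := fun j n => d_t phi (Z j, T n)) (q := fun j n => d_x (d_x phi) (Z j, T n))) => //.
- move=> j n jk nl; rewrite !ZS TS.
  have := step (j%:Z - k%:Z) n; rewrite /= intrB ZX ZS addrK; apply; lia.
- by move=> n; apply: b0.
- by move=> n; apply: b0.
- by move=> n; apply: b0; lia.
- by move=> n; apply: b0; lia.
- by move=> j; rewrite phiA// Tl orbT.
- by move=> j; rewrite tphiA// Tl orbT.
- move=> j n; rewrite TS.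
  exact: (first_difference_bound (b := true) (Z j) (T n) ttC dt0).
- move=> j n; rewrite !ZS.
  have := second_difference_bound (b := false) (T n) (Z j + dx) xxxC dx0.
  by rewrite addrK.
Qed.

(** * Transfer *)

Section Transfer.
Context (R : realType) (I : Type) (F : ultrafilter_on I).

Lemma infinitesimal_cvg (f : I -> R) :
  infinitesimal (cls F f) <-> f i @[i --> uset F] --> (0 : R).
Proof.
split=> [finf|/cvgrPdist_lt f0 e e0].
  apply/cvgrPdist_lt => e /finf; rewrite cls_norm => /cls_lt.
  by apply: filterS => i; rewrite sub0r normrN.
rewrite cls_norm; apply/cls_lt; apply: filterS (f0 e e0) => i.
by rewrite sub0r normrN.
Qed.

Lemma not_limited_cls (f : I -> R) (M : R) :
  ~ limited (cls F f) -> \forall i \near uset F, M < `|f i|.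
Proof.
move=> nf; have /ultra_not : ~ \forall i \near uset F, `|f i| <= M.
  by move=> fM; apply: nf; exists M; rewrite cls_norm; apply/cls_le.
by apply: filterS => i /negP; rewrite -ltNge.
Qed.

(** Uniqueness of limits pins down the point that [xget] selects. *)
Lemma St_cvg (f : I -> R) (l : R) :
  f i @[i --> uset F] --> l -> St (cls F f) = l.
Proof.
have iff_cvg r : infinitesimal (cls F f - std F r) <-> f i @[i --> uset F] --> r.
  rewrite clsN clsD infinitesimal_cvg;
  by split=> /cvgrPdist_lt h; apply/cvgrPdist_lt => e /h; apply: filterS => i;
    rewrite sub0r normrN distrC.
move=> fl; apply: xget_subset1; first exact/iff_cvg.
move=> r s /iff_cvg fr /iff_cvg fs.
exact: (cvg_unique (@Rhausdorff R) fr fs).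
Qed.

(** The image of an ultrafilter is an ultrafilter, and this one contains the compact segment
    [[- C, C]]. *)
Lemma ultra_bounded_cvg (f : I -> R) (C : R) :
  (\forall i \near uset F, `|f i| <= C) ->
  exists2 l : R, `|l| <= C & f i @[i --> uset F] --> l.
Proof.
move=> fC; have UF : UltraFilter (f i @[i --> uset F]).
  split=> [|G GF sFG]; first exact: fmap_proper_filter.
  apply/seteqP; split => // A GA; apply: contrapT => /ultra_not nA.
  have /sFG GnA : (f i @[i --> uset F]) (~` A) by exact: nA.
  by have /filter_ex[x []] : G (A `&` ~` A) by exact: filterI.
have := @segment_compact R (- C) C; rewrite compact_ultra => /(_ _ UF)[|l [lC fl]].
  by apply: filterS fC => i; rewrite ler_norml /= in_itv.
by exists l => //; rewrite ler_norml; move: lC; rewrite /= in_itv.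
Qed.

Context (dx dt : I -> R) (N : I -> nat).
Let sdx := cls F dx.
Let sdt := cls F dt.
Let sN := cls F (fun i => (N i)%:R : R).

(** [gridC_hyperfinite] yields only some internal set; evaluating the hyperfinite sum takes an
    explicit representative. *)
Lemma gridC_internal :
  gridC sdx sdt sN = sset (cls F (fun i => grid (dx i) (dt i) (N i)%:R)).
Proof.
apply/seteqP; split=> [z [m [n []]]|].
  elim/(@starW _ F R): m => m; elim/(@starW _ F R): n => n.
  move=> /ssetE mZ /ssetE nN.
  rewrite cls_norm clsD => /cls_le mnN ->; rewrite !clsM /spair smap2E; apply/ssetE.
  move: mZ nN mnN; apply: filterS3 => i [a _ <-] [b _ <-] ab.
  by exists a, b.
elim/(@starW _ F (R * R)%type) => z /ssetE Gz.
have [m mP] := near_choice Gz.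
have [n nP] := near_choice mP.
exists (cls F (fun i => (m i)%:~R)), (cls F (fun i => (n i)%:R)); split.
- by apply/ssetE/nearW => i; exists (m i).
- by apply/ssetE/nearW => i; exists (n i).
- by rewrite cls_norm clsD; apply/cls_le; apply: filterS nP => i [].
- by rewrite !clsM /spair smap2E; apply/clsP; apply: filterS nP => i [].
Qed.

Lemma hsum_gridC (U : star F (R * R) -> star F R) (V : I -> R * R -> R)
    (phi : R * R -> R) :
  (forall z, gridC sdx sdt sN z -> U z = Defs.sfun (cls F V) z) ->
  hsum (gridC sdx sdt sN) (fun z => U z * smap phi z * sdx * sdt) =
  cls F (fun i => \sum_(z \in grid (dx i) (dt i) (N i)%:R)
                    (V i z * phi z * dx i * dt i)).
Proof.
move=> UV; apply: hsumE.
exists (cls F (fun i => grid (dx i) (dt i) (N i)%:R)).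
exists (cls F (fun i z => V i z * phi z * dx i * dt i)); split.
- exact: gridC_internal.
- by have [B /esym + Bfin] := gridC_hyperfinite sdx sdt sN;
    rewrite gridC_internal => /(@sset_inj _ _ _ _ _) <-.
- elim/(@starW _ F (R * R)%type) => z Gz.
  rewrite UV// !sfunE smapE /sdx /sdt (clsM F (fun i => V i (z i))).
  by rewrite (clsM F (fun i => V i (z i) * phi (z i))) clsM.
- exact/esym/smap2E.
Qed.

Lemma grid_finite : \forall i \near uset F, finite_set (grid (dx i) (dt i) (N i)%:R).
Proof.
have [B /esym + Bfin] := gridC_hyperfinite sdx sdt sN.
rewrite gridC_internal => /(@sset_inj _ _ _ _ _) BE.
by move: Bfin; rewrite BE => /ssetE.
Qed.

Lemma mem_gridC (m : I -> int) (n : I -> nat) :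
  (\forall i \near uset F, (`|m i| + n i <= N i)%N) ->
  gridC sdx sdt sN (cls F (fun i => ((m i)%:~R * dx i, (n i)%:R * dt i))).
Proof.
move=> mnN; rewrite gridC_internal; apply/ssetE; apply: filterS mnN => i mnN.
exists (m i), (n i); split=> //.
by rewrite -intr_norm -natr_absz -natrD ler_nat.
Qed.

Lemma cls_step_eq (a b c d x t : I -> R) :
  (cls F a - cls F b) / cls F t =
    (cls F c - 2 * cls F b + cls F d) / cls F x ^+ 2 <->
  \forall i \near uset F, (a i - b i) / t i = (c i - 2 * b i + d i) / x i ^+ 2.
Proof.
have two : 2 = cls F (fun=> 2) :> star F R.
  by rewrite -[LHS]/(cls F (fun=> 1) + cls F (fun=> 1)) clsD.
rewrite two (clsN F b) (clsD F a) (clsV F t) (clsM F (fun i => a i - b i)).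
rewrite (clsM F (fun=> 2) b) (clsN F (fun i => 2 * b i)) (clsD F c).
rewrite (clsD F (fun i => c i - 2 * b i)) expr2 (clsM F x x).
rewrite (clsV F (fun i => x i * x i)) (clsM F (fun i => c i - 2 * b i + d i)).
exact: clsP.
Qed.

(** Transfer by contradiction: if a condition failed at almost every index, choosing a violating
    pair of integers at each would give a hyperinteger and a hypernatural at which the nonstandard
    hypothesis fails. *)
Lemma heat_scheme_transfer (u0 : R -> R) (U : star F (R * R) -> star F R)
    (V : I -> R * R -> R) :
  0 < sdx -> 0 < sdt -> sdt / sdx ^+ 2 <= 1 / 2 ->
  (forall z, gridC sdx sdt sN z -> U z = Defs.sfun (cls F V) z) ->
  (forall x, gridC sdx sdt sN (spair x 0) -> U (spair x 0) = smap u0 x) ->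
  (forall m n, hyperint m -> hypernat n -> `|m| + n < sN ->
      let x := m * sdx in let t := n * sdt in
      (U (spair x (t + sdt)) - U (spair x t)) / sdt =
      (U (spair (x + sdx) t) - 2 * U (spair x t) + U (spair (x - sdx) t))
        / sdx ^+ 2) ->
  \forall i \near uset F, heat_scheme u0 (dx i) (dt i) (N i) (V i).
Proof.
move=> /cls_lt dx0 /cls_lt dt0 cfl UV init step.
have {}cfl : \forall i \near uset F, dt i / dx i ^+ 2 <= 1 / 2.
  have half : (1 / 2 : star F R) = cls F (fun=> 1 / 2).
    by rewrite -[1 in LHS]/(cls F (fun=> 1)) -[2 in LHS]/(cls F (fun=> 1) + cls F (fun=> 1))
      clsD clsV clsM.
  move: cfl; rewrite half expr2 /sdx /sdt (clsM F dx dx).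
  by rewrite (clsV F (fun i => dx i * dx i)) (clsM F dt) => /cls_le.
have {}init : \forall i \near uset F, forall m : int, (`|m| <= N i)%N ->
    V i (m%:~R * dx i, 0) = u0 (m%:~R * dx i).
  apply: contrapT => /ultra_not nV.
  have /near_choice[m mP] : \forall i \near uset F, exists m : int,
     (`|m| <= N i)%N /\ V i (m%:~R * dx i, 0) <> u0 (m%:~R * dx i).
    apply: filterS nV => i; apply: contra_notP => /forallNP nm m mN.
    by apply: contrapT => nE; apply: (nm m).
  have Gm : gridC sdx sdt sN (cls F (fun i => ((m i)%:~R * dx i, 0))).
    have -> : (fun i => ((m i)%:~R * dx i, 0)) =
        (fun i => ((m i)%:~R * dx i, 0%N%:R * dt i)).
      by apply/funext => i; rewrite mul0r.
    by apply: (mem_gridC (n := fun=> 0%N)); apply: filterS mP => i []; rewrite addn0.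
  have := init (cls F (fun i => (m i)%:~R * dx i)).
  rewrite /spair smap2E smapE => /(_ Gm); rewrite UV// sfunE => /clsP E.
  by apply: (near_absurd mP E) => i [].
have {}step : \forall i \near uset F, forall (m : int) (n : nat), (`|m| + n < N i)%N ->
    let x := m%:~R * dx i in let t := n%:R * dt i in
    (V i (x, t + dt i) - V i (x, t)) / dt i =
    (V i (x + dx i, t) - 2 * V i (x, t) + V i (x - dx i, t)) / dx i ^+ 2.
  apply: contrapT => /ultra_not nV.
  have /near_choice[m /near_choice[n mnP]] : \forall i \near uset F, exists (m : int) (n : nat),
     (`|m| + n < N i)%N /\
     (V i (m%:~R * dx i, n%:R * dt i + dt i) - V i (m%:~R * dx i, n%:R * dt i)) / dt i <>
     (V i (m%:~R * dx i + dx i, n%:R * dt i) - 2 * V i (m%:~R * dx i, n%:R * dt i)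
       + V i (m%:~R * dx i - dx i, n%:R * dt i)) / dx i ^+ 2.
    apply: filterS nV => i; apply: contra_notP => /forallNP nm m n mN.
    by apply: contrapT => nE; apply: (nm m); exists n.
  have mnN : \forall i \near uset F, (`|m i| + n i < N i)%N by apply: filterS mnP => i [].
  (* [U] agrees with the class of [V] only on the grid, so each point of the stencil has to be shown
     to lie there; the strict bound on [|m| + n] leaves room for the neighbours. *)
  have UE (p : I -> int) (q : I -> nat) (z : I -> R * R) :
      (\forall i \near uset F, (`|p i| + q i <= N i)%N) ->
      (forall i, z i = ((p i)%:~R * dx i, (q i)%:R * dt i)) ->
      U (cls F z) = cls F (fun i => V i (z i)).
    by move=> pqN /funext zE; rewrite UV ?sfunE// zE; exact: mem_gridC.
  have := step (cls F (fun i => (m i)%:~R)) (cls F (fun i => (n i)%:R)).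
  rewrite /sdx /sdt /= (clsM F _ dx) (clsM F _ dt) (clsN F dx)
    (clsD F (fun i => (n i)%:R * dt i)) !(clsD F (fun i => (m i)%:~R * dx i)).
  rewrite /spair !smap2E.
  have mnN' : \forall i \near uset F, (`|m i| + n i <= N i)%N.
    by apply: filterS mnN => i; exact: ltnW.
  rewrite (UE m n (fun i => ((m i)%:~R * dx i, (n i)%:R * dt i)) mnN' (fun i => erefl)).
  rewrite (UE m (fun i => (n i).+1) (fun i => ((m i)%:~R * dx i, (n i)%:R * dt i + dt i))).
  - rewrite (UE (fun i => m i + 1) n (fun i => ((m i)%:~R * dx i + dx i, (n i)%:R * dt i))).
    + rewrite (UE (fun i => m i - 1) n (fun i => ((m i)%:~R * dx i - dx i, (n i)%:R * dt i))).
      * move=> E; apply: (near_absurd mnP (iffLR (cls_step_eq _ _ _ _ _ _) (E _ _ _))).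
        - by apply/ssetE/nearW => i; exists (m i).
        - by apply/ssetE/nearW => i; exists (n i).
        - rewrite cls_norm (clsD F (fun i => `|(m i)%:~R|)); apply/cls_lt.
          apply: filterS mnN => i mn.
          by rewrite -intr_norm -natr_absz -natrD ltr_nat.
        - by move=> i [].
      * by apply: filterS mnN => i; lia.
      * by move=> i; congr (_, _); rewrite intrB mulrBl mul1r.
    + by apply: filterS mnN => i; lia.
    + by move=> i; congr (_, _); rewrite intrD mulrDl mul1r.
  - by apply: filterS mnN => i; lia.
  - by move=> i; congr (_, _); rewrite -addn1 natrD mulrDl mul1r.
apply: filterS (filterI dx0 (filterI dt0 (filterI cfl (filterI init step)))).
by move=> i [? [? [? [? ?]]]]; split.
Qed.

End Transfer.

(** * Sums against test functions *)

Lemma mesh_index (R : realType) (A h : R) : 0 < A -> 0 < h -> h <= 1 ->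
  exists2 k : nat, A < k%:R * h & k%:R * h <= A + 1.
Proof.
move=> A0 h0 h1; have Ah : 0 <= (A + 1) / h by rewrite divr_ge0 ?(ltW h0)//; lra.
(* Rounding down loses less than [h <= 1], so [k%:R * h] still exceeds [A]. *)
exists (Num.truncn ((A + 1) / h)).
  have : A + 1 < (Num.truncn ((A + 1) / h)).+1%:R * h.
    by rewrite -ltr_pdivrMr// truncnS_gt.
  by rewrite -addn1 natrD; lra.
by rewrite -ler_pdivlMr// truncn_le.
Qed.

Section GridSums.
Context (R : realType) (I : Type) (F : ultrafilter_on I).
Context (u0 : R -> R) (M : R) (u0M : forall x, `|u0 x| <= M).
Context (dx dt : I -> R) (N : I -> nat) (V : I -> R * R -> R).
Context (scheme : \forall i \near uset F, heat_scheme u0 (dx i) (dt i) (N i) (V i))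
  (dx_cvg0 : dx i @[i --> uset F] --> (0 : R))
  (dt_cvg0 : dt i @[i --> uset F] --> (0 : R))
  (Ndx_unbounded : forall B : R, \forall i \near uset F, B < (N i)%:R * dx i)
  (Ndt_unbounded : forall B : R, \forall i \near uset F, B < (N i)%:R * dt i).

Definition grid_sum (f : R * R -> R) (i : I) : R :=
  \sum_(z \in grid (dx i) (dt i) (N i)%:R) (V i z * f z * dx i * dt i).

Lemma cvg0_near_lt (f : I -> R) (e : R) : f i @[i --> uset F] --> (0 : R) ->
  0 < e -> \forall i \near uset F, f i < e.
Proof.
move=> /cvgrPdist_lt f0 e0; apply: filterS (f0 e e0) => i.
by rewrite sub0r normrN; apply: le_lt_trans; exact: ler_norm.
Qed.

(** As [N * dx] and [N * dt] eventually exceed [2 * (A + 1)], both [k] and [l] stay below [N / 2],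
    so the rectangle that covers the support fits in the triangle. *)
Lemma near_mesh (A : R) : 0 < A -> \forall i \near uset F, exists k l : nat,
  [/\ A < k%:R * dx i, A < l%:R * dt i, (k + l <= N i)%N,
      k%:R * dx i <= A + 1 &
      k.*2.+1%:R * dx i <= 2 * A + 3 /\ l%:R * dt i <= A + 1].
Proof.
move=> A0; have dx1 := cvg0_near_lt dx_cvg0 ltr01.
have dt1 := cvg0_near_lt dt_cvg0 ltr01.
apply: filterS (filterI scheme (filterI dx1 (filterI dt1
  (filterI (Ndx_unbounded (2 * (A + 1))) (Ndt_unbounded (2 * (A + 1))))))).
move=> i [[dx0 dt0 _ _ _] [/ltW dx1i [/ltW dt1i [Ndx Ndt]]]].
have [k Ak kA] := mesh_index A0 dx0 dx1i.
have [l Al lA] := mesh_index A0 dt0 dt1i.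
exists k, l; split=> //; last by split=> //; rewrite -addn1 -addnn !natrD; lra.
have kN : (k.*2 < N i)%N.
  by rewrite -(ltr_nat R) -(ltr_pM2r dx0) -addnn natrD; lra.
have lN : (l.*2 < N i)%N.
  by rewrite -(ltr_nat R) -(ltr_pM2r dt0) -addnn natrD; lra.
lia.
Qed.

(** [D] is fixed before [psi], as area times [M]; this gives limitedness of the sums and continuity
    of [u] alike. *)
Lemma grid_sum_bounded (K : set (R * R)) : compact K ->
  exists D : R, forall (psi : R * R -> R) (C : R),
    supp psi `<=` K -> (forall z, `|psi z| <= C) ->
    \forall i \near uset F, `|grid_sum psi i| <= D * C.
Proof.
move=> /compact_square[A A0 KA]; exists ((2 * A + 3) * (A + 1) * M) => psi C psiK psiC.
have M0 : 0 <= M by apply: le_trans (u0M 0).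
have C0 : 0 <= C by apply: le_trans (psiC (0, 0)).
apply: filterS (filterI scheme (near_mesh A0)).
move=> i [hV [k [l [Ak Al klN _ [kA lA]]]]].
apply: le_trans (grid_sum_bound u0M hV Ak Al klN (KA _ psiK) psiC) _.
rewrite -(mulrA _ M) ler_wpM2r ?mulr_ge0//; have [dx0 dt0 _ _ _] := hV.
by rewrite ler_pM// mulr_ge0// ltW.
Qed.

(** Splitting the sum uses finiteness of the grid, which is available at almost every index. *)
Lemma grid_sum_linear (a : R) (f g : R * R -> R) :
  \forall i \near uset F, grid_sum (a *: f + g) i = a * grid_sum f i + grid_sum g i.
Proof.
apply: filterS (grid_finite F dx dt N) => i Gfin.
rewrite /grid_sum mulr_fsumr -fsbig_split//=; apply: eq_fsbigr => z _.
by rewrite -[(a *: f + g) z]/(a * f z + g z); ring.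
Qed.

Lemma grid_sum_weak_cvg (phi : testfun R) : continuous u0 ->
  grid_sum (- d_t phi - d_x (d_x phi) : testfun R) i @[i --> uset F] -->
  \int[lebesgue_measure]_x (u0 x * phi (x, 0)).
Proof.
move=> u0_continuous; set v := (- d_t phi - d_x (d_x phi) : testfun R).
have [A A0 KA] := compact_square (compactU (testfun_compact (f:=phi))
  (compactU (testfun_compact (f:=d_t phi)) (testfun_compact (f:=v)))).
have phiA : vanishes_off_square A phi by apply: KA => z; left.
have tphiA : vanishes_off_square A (d_t phi) by apply: KA => z; right; left.
have vA : vanishes_off_square A v by apply: KA => z; right; right.
have [Ct tC] := testfun_bounded (d_t phi).
have [Ctt ttC] := testfun_bounded (d_t (d_t phi)).
have [Cx xC] := testfun_bounded (d_x (d_x (d_x phi))).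
have M0 : 0 <= M by apply: le_trans (u0M 0).
have Ct0 : 0 <= Ct by apply: le_trans (tC (0, 0)).
have Ctt0 : 0 <= Ctt by apply: le_trans (ttC (0, 0)).
have Cx0 : 0 <= Cx by apply: le_trans (xC (0, 0)).
pose g x := u0 x * phi (x, 0).
have g_cont : continuous g.
  move=> x; apply: cvgM; first exact: u0_continuous.
  apply: (@continuous_comp _ _ _ (fun x : R => (x, 0 : R)) phi); last exact: testfun_continuous.
  exact: (cvg_pair (@cvg_id _ (nbhs x)) (cvg_cst (0 : R))).
have gA x : A < `|x| -> g x = 0 by move=> Ax; rewrite /g phiA ?Ax// mulr0.
apply/cvgrPdist_le => e e0.
have e20 : 0 < e / 2 by rewrite divr_gt0.
have riemann : \forall i \near uset F, forall k : nat, 0 < dx i ->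
    A < k%:R * dx i -> k%:R * dx i <= A + 1 ->
    `|(\sum_(j < k.*2.+1) g ((j%:R - k%:R) * dx i)) * dx i -
      \int[lebesgue_measure]_x g x| <= e / 2.
  exact: dx_cvg0 (riemann_sum_cvg g_cont gA A0 e20).
(* When [dx] and [dt] are below [d], the consistency error of [grid_weak_form] is at most [B * d];
   the [+ 1] in [d] covers [B = 0]. The Riemann sum takes the other half of [e]. *)
pose B := (2 * A + 3) * (A + 1) * (M * (Ctt + Cx)) + (2 * A + 3) * (M * Ct).
have B0 : 0 <= B.
  by rewrite addr_ge0// !mulr_ge0// ?addr_ge0// ?mulr_ge0//; lra.
pose d := e / (2 * (B + 1)).
have d0 : 0 < d by rewrite divr_gt0// mulr_gt0//; lra.
apply: filterS (filterI scheme (filterI (near_mesh A0) (filterI riemann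
  (filterI (cvg0_near_lt dx_cvg0 d0) (cvg0_near_lt dt_cvg0 d0))))).
move=> i [hV [[k [l [Ak Al klN kA1 [kA lA]]]] [riem [dxd dtd]]]].
have [dx0 dt0 _ _ _] := hV.
have := grid_weak_form u0M hV Ak Al klN phiA tphiA vA tC ttC xC.
have := riem k dx0 Ak kA1; rewrite /g => riem1 weak.
rewrite distrC; set s := (X in `|X - _| <= _) in riem1.
rewrite -(subrK s (grid_sum _ _)) -addrA.
apply: le_trans (ler_normD _ _) _.
have -> : e = e / 2 + e / 2 by lra.
apply: lerD => //; apply: le_trans weak _.
have Bd : B * d <= e / 2.
  have -> : e / 2 = (B + 1) * d by rewrite /d; field; lra.
  by rewrite ler_wpM2r ?(ltW d0)//; lra.
apply: le_trans Bd; rewrite /B mulrDl -[_ * _ * _ * d]mulrA -[(2 * A + 3) * _ * d]mulrA.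
have Md : 0 <= M * (Ctt * dt i + Cx * dx i).
  by rewrite mulr_ge0// addr_ge0// mulr_ge0// ltW.
apply: lerD.
  apply: ler_pM => //; first by rewrite !mulr_ge0// ltW.
    by rewrite ler_pM// mulr_ge0// ltW.
  rewrite -mulrA ler_wpM2l// mulrDl; apply: lerD; apply: ler_wpM2l => //; exact: ltW.
rewrite -mulrA; apply: ler_pM => //; first by rewrite mulr_ge0// ltW.
  by rewrite !mulr_ge0// ltW.
by rewrite ler_wpM2l ?mulr_ge0// ltW.
Qed.

End GridSums.

(** * Continuity of functionals bounded by sup norms *)

(** Under such a bound the sets where [|u f| < r] are basic neighbourhoods of 0, and by linearity
    their translates make preimages of balls open. *)
Lemma scalar_continuous (R : realType) (u : testfun R -> R) : scalar u ->
  (forall K : set (R * R), compact K -> exists D : R, forall (f : testfun R) (C : R),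
    supp f `<=` K -> (forall z, `|f z| <= C) -> `|u f| <= D * C) ->
  continuous u.
Proof.
move=> ulin ubound.
have u0 : u 0 = 0 by have := ulin (-1) 0 0; rewrite scaler0 addr0; lra.
have uZ a f : u (a *: f) = a * u f by have := ulin a f 0; rewrite !addr0 u0 addr0.
have uB f g : u (f - g) = u f - u g.
  by rewrite (addrC f) -scaleN1r ulin mulN1r addrC.
have uD f g : u (f + g) = u f + u g by have := ulin 1 f g; rewrite scale1r mul1r.
have base (r : R) : 0 < r -> nbhs0_base [set f | `|u f| < r].
  move=> r0; split=> /=.
  - by rewrite u0 normr0.
  - apply/convex_setW => f g; rewrite !inE/= => fr gr k k0 k1.
    rewrite inE/= -[conv k _ _]/(k%:num *: f + (1 - k%:num) *: g) uD !uZ.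
    apply: le_lt_trans (ler_normD _ _) _; rewrite !normrM (gtr0_norm k0).
    rewrite (ger0_norm (x := 1 - k%:num)); last by rewrite subr_ge0 ltW.
    have : k%:num * `|u f| < k%:num * r by rewrite ltr_pM2l.
    have : (1 - k%:num) * `|u g| < (1 - k%:num) * r by rewrite ltr_pM2l ?subr_gt0.
    lra.
  - by move=> a f a1 fr; rewrite uZ normrM; apply: le_lt_trans fr; rewrite ler_piMl.
  (* Order 0 suffices, as the bound involves no derivatives; [|D| + 1] replaces [D], which need not
     be positive. *)
  - move=> K cK f fr fK; have [D uD'] := ubound K cK; exists 0%N.
    have D0 : 0 < `|D| + 1 by have := normr_ge0 D; lra.
    pose e := (r - `|u f|) / (`|D| + 1).
    have e_gt0 : 0 < e by rewrite divr_gt0// subr_gt0.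
    exists e; split=> //.
    move=> g gK fg; have gfK : supp (g - f) `<=` K.
      have /closure_id -> : closed K by apply: compact_closed => //; exact: Rhausdorff.
      apply: closureS => z /=; apply: contraPP => zK.
      have h0 (h : testfun R) : supp h `<=` K -> h z = 0.
        move=> hK; apply/eqP/negPn/negP => hz; apply: zK; apply: hK.
        exact: subset_closure.
      by apply/negP/negPn/eqP; rewrite -[LHS]/(g z - f z) !h0// subrr.
    have gfe z : `|(g - f) z| <= e by apply/ltW/(fg [::] z).
    have := uD' _ _ gfK gfe; rewrite uB => ugf.
    have De : D * e < r - `|u f|.
      have -> : r - `|u f| = (`|D| + 1) * e by rewrite /e; field; lra.
      rewrite (ltr_pM2r e_gt0); have := ler_norm D; lra.
    have := ler_normD (u g - u f) (u f); rewrite subrK /=; lra.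
move=> f A /nbhs_ballP[e /= e0 eA]; rewrite nbhsE.
exists [set g | `|u f - u g| < e]; last by move=> g; rewrite -ball_normE in eA; exact: eA.
split=> /=; last by rewrite subrr normr0.
move=> g /= ge; exists [set h | `|u h| < e - `|u f - u g|].
  by apply: base; rewrite subr_gt0.
move=> h /=; rewrite uB => hg.
have := ler_normD (u f - u g) (- (u h - u g)); rewrite normrN.
have -> : u f - u g - (u h - u g) = u f - u h by ring.
lra.
Qed.
Theorem theorem3p3p1 (R : realType) (I : Type) (F : ultrafilter_on I)
    (u0 : R -> R) (u0_bounded : bounded_fun u0) (u0_continuous : continuous u0)
    (dx dt : star F R)
    (dx_gt0 : 0 < dx) (dx_inf : infinitesimal dx)
    (dt_gt0 : 0 < dt) (dt_inf : infinitesimal dt)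
    (N : star F R) (N_nat : hypernat N) (N_unlim : ~ limited N)
    (Ndx_unlim : ~ limited (N * dx)) (Ndt_unlim : ~ limited (N * dt))
    (alpha_le : dt / dx ^+ 2 <= 1 / 2)
    (U : star F (R * R) -> star F R)
    (U_internal : internal_on (gridC dx dt N) U)
    (U_init : forall x, gridC dx dt N (spair x 0) ->
      U (spair x 0) = smap u0 x)
    (U_eqn : forall m n, hyperint m -> hypernat n -> `|m| + n < N ->
      let x := m * dx in let t := n * dt in
      (U (spair x (t + dt)) - U (spair x t)) / dt =
      (U (spair (x + dx) t) - 2 * U (spair x t) + U (spair (x - dx) t))
        / dx ^+ 2) :
  let sumC (phi : testfun R) : star F R :=
    hsum (gridC dx dt N) (fun z => U z * smap phi z * dx * dt) in
  let u (phi : testfun R) : R := St (sumC phi) in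
  (forall phi, limited (sumC phi)) /\
  is_distribution u /\
  forall phi : testfun R,
    u (- d_t phi - d_x (d_x phi)) =
    \int[lebesgue_measure]_x (u0 x * phi (x, 0)).
Proof.
move: dx_gt0 dx_inf dt_gt0 dt_inf N_nat N_unlim Ndx_unlim Ndt_unlim alpha_le
  U_internal U_init U_eqn.
elim/(@starW _ F R): dx => dx; elim/(@starW _ F R): dt => dt.
elim/(@starW _ F R): N => N dx0 /infinitesimal_cvg dx_cvg0 dt0.
move=> /infinitesimal_cvg dt_cvg0 /ssetE NN N_unlim Ndx Ndt cfl.
(* A hypernatural is represented by honest naturals almost everywhere, so the grids below have
   natural sizes. *)
have [n nN] : exists n : I -> nat, \forall i \near uset F, (n i)%:R = N i.
  by apply: (near_choice (P := fun i k => k%:R = N i)); apply: filterS NN => i [k _ <-]; exists k.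
have {NN} NE : cls F N = cls F (fun i => (n i)%:R).
  by apply/clsP; apply: filterS nN => i ->.
rewrite {}NE in N_unlim Ndx Ndt *.
move=> [g]; elim/(@starW _ F (R * R -> R)): g => V UV U_init U_eqn.
have [M u0M] : exists M, forall x, `|u0 x| <= M.
  have [M _ u0M] := pinfty_ex_gt0 u0_bounded.
  by exists M => x; exact: u0M.
have scheme := heat_scheme_transfer dx0 dt0 cfl UV U_init U_eqn.
have dx0' := iffLR (cls_lt _ _ _) dx0.
have dt0' := iffLR (cls_lt _ _ _) dt0.
have Ndx_unbounded (B : R) : \forall i \near uset F, B < (n i)%:R * dx i.
  move: Ndx; rewrite clsM => /(not_limited_cls B) nB.
  apply: filterS2 dx0' nB => i dxi; rewrite ger0_norm// mulr_ge0//; exact: ltW.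
have Ndt_unbounded (B : R) : \forall i \near uset F, B < (n i)%:R * dt i.
  move: Ndt; rewrite clsM => /(not_limited_cls B) nB.
  apply: filterS2 dt0' nB => i dti; rewrite ger0_norm// mulr_ge0//; exact: ltW.
move=> sumC u; pose S := grid_sum dx dt n V.
have sumCE phi : sumC phi = cls F (S phi) by exact: hsum_gridC.
have bounded := grid_sum_bounded u0M scheme dx_cvg0 dt_cvg0 Ndx_unbounded Ndt_unbounded.
(* The sums are bounded, hence converge along the ultrafilter, and their limit is the standard
   part. *)
have u_cvg (phi : testfun R) : S phi i @[i --> uset F] --> u phi.
  have [D DP] := bounded _ (testfun_compact (f:=phi)).
  have [C phiC] := testfun_bounded phi.
  have [l _ Sl] := ultra_bounded_cvg (DP phi C (fun _ => id) phiC).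
  by rewrite /u sumCE (St_cvg Sl).
split; [|split].
- move=> phi; have [D DP] := bounded _ (testfun_compact (f:=phi)).
  have [C phiC] := testfun_bounded phi.
  exists (D * C); rewrite sumCE cls_norm; apply/cls_le.
  exact: DP.
- have ulin : scalar u.
    move=> a f h /=.
    have cS : (a * S f i + S h i) @[i --> uset F] --> a * u f + u h.
      by apply: cvgD => //; apply: cvgMr.
    apply: (cvg_unique (@Rhausdorff R) (u_cvg _)).
    apply: cvg_trans cS; apply: near_eq_cvg.
    by apply: filterS (grid_sum_linear F dx dt n V a f h) => i.
  split=> //; apply: scalar_continuous => // K /bounded[D DP].
  (* The limit inherits the bound [D * C] of the grid sums. *)
  exists D => f C fK fC; have [l lDC Sl] := ultra_bounded_cvg (DP f C fK fC).
  by rewrite (cvg_unique (@Rhausdorff R) (u_cvg f) Sl).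
- move=> phi; apply: (cvg_unique (@Rhausdorff R) (u_cvg _)).
  exact: grid_sum_weak_cvg.
Qed.
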